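(* Let $t$ be a positive integer and let $\mu_1,\mu_2,\dots,\mu_t$ be probability measures on $\mathbb{R}^2$ that are absolutely continuous with respect to Lebesgue measure. Then there is a stair-like path using at most $t-1$ turns which splits $\mathbb{R}^2$ into two sets $A,B$ such that $$\mu_i(A)=\mu_i(B)=\tfrac12\qquad\text{for all } i=1,\dots,t.$$
   Context: A stair-like path is a $y$-monotone path made only of vertical and horizontal segments and not self-intersecting, where the path is allowed to go through infinity in the horizontal direction and some of its vertical segments are allowed to be at infinity. Explicitly: identify the two ends of the $x$-axis, so that abscissas lie in the circle $\mathbb{R}\cup\{\infty\}$. A stair-like path is a finite sequence of segments, alternately vertical and horizontal, traversed with increasing $y$. The horizontal segments lie at real heights $y_1<y_2<\dots$ (strictly increasing). Each vertical segment lies at an abscissa in $\mathbb{R}\cup\{\infty\}$ and covers the range of heights between two consecutive horizontal segments; if the path begins (respectively ends) with a vertical segment, that segment extends down to $y=-\infty$ (respectively up to $y=+\infty$). A horizontal segment between two vertical segments at abscissas $x$ and $x'$ is an arc of the circle $\mathbb{R}\cup\{\infty\}$ (at the given height) from $x$ to $x'$; it may contain $\infty$ (this is ''going through infinity''), and if $x=x'$ it may be the trivial arc or the whole circle. If the path begins (or ends) with a horizontal segment, that segment starts (or ends) at abscissa $\infty$. The number of turns is the number of changes between vertical and horizontal segments, i.e. the number of segments minus one (segments at infinity are counted as segments). The path splits $\mathbb{R}^2$ into $A$ and $B$ when $A$ and $B$ are the two colour classes of the 2-colouring of the complement in $\mathbb{R}^2$ of the path (the part of the path with finite abscissa), in which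 the colour changes exactly when one of its segments is crossed. The points on the path itself form a null set and may be assigned arbitrarily. *)

(* Defs.v *)
From HB Require Import structures.
From mathcomp Require Import all_boot all_order all_algebra.
From mathcomp Require Import all_classical all_reals all_analysis.

Set Implicit Arguments.
Unset Strict Implicit.
Unset Printing Implicit Defensive.

Import Order.TTheory GRing.Theory Num.Theory.
Import numFieldNormedType.Exports.

Local Open Scope classical_set_scope.
Local Open Scope ring_scope.

(* The circle of abscissas: [Some x] is the real x, [None] is infinity. *)
Notation abscissa R := (one_point_compactification R).

(* How a horizontal segment goes round the circle of abscissas: in the
   increasing direction (through infinity from +oo to -oo), in the decreasing
   direction, or once around the whole circle.  The first two give the trivial
   arc when the endpoints coincide. *)
Inductive winding := Increasing | Decreasing | FullCircle.

(* [Vertical x y0 y1] goes up from height y0 to height y1 at abscissa x;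
   [Horizontal y x0 x1 w] goes from abscissa x0 to abscissa x1 at height y. *)
Inductive segment (R : realType) :=
  | Vertical of abscissa R & \bar R & \bar R
  | Horizontal of R & abscissa R & abscissa R & winding.

Section StairLikePaths.
Variable R : realType.
Implicit Types (s : segment R) (p : seq (segment R)) (A B : set (R * R)).

Definition is_vertical s : bool :=
  if s is Vertical _ _ _ then true else false.

Definition source s : abscissa R * \bar R :=
  match s with
  | Vertical x y0 _ => (x, y0)
  | Horizontal y x0 _ _ => (x0, y%:E)
  end.

Definition target s : abscissa R * \bar R :=
  match s with
  | Vertical x _ y1 => (x, y1)
  | Horizontal y _ x1 _ => (x1, y%:E)
  end.

Definition segment_ok s : bool :=
  match s with
  | Vertical _ y0 y1 => (y0 < y1)%E
  | Horizontal _ x0 x1 w => if w is FullCircle then x0 == x1 else true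
  end.

Definition consecutive s s' : bool :=
  (is_vertical s != is_vertical s') && (target s == source s').

Definition start_ok s : bool :=
  if is_vertical s then (source s).2 == -oo%E else (source s).1 == None.

Definition end_ok s : bool :=
  if is_vertical s then (target s).2 == +oo%E else (target s).1 == None.

(* The heights of the horizontal segments increase strictly, because two
   successive ones are joined by a vertical segment with y0 < y1. *)
Definition stair_like_path p : bool :=
  if p is s :: p' then
    [&& all segment_ok p, path consecutive s p', start_ok s
      & end_ok (last s p')]
  else false.

Definition turns p : nat := (size p).-1.

(* The finite points of the closed arc from a to b in the increasing
   direction, which is trivial when a = b. *)
Definition increasing_arc (a b : abscissa R) : set R :=
  match a, b with
  | Some x0, Some x1 => if x0 <= x1 then [set x | x0 <= x <= x1]
                        else [set x | x0 <= x \/ x <= x1]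
  | Some x0, None => [set x | x0 <= x]
  | None, Some x1 => [set x | x <= x1]
  | None, None => set0
  end.

Definition arc (a b : abscissa R) (w : winding) : set R :=
  match w with
  | Increasing => increasing_arc a b
  | Decreasing => increasing_arc b a
  | FullCircle => setT
  end.

(* The part of a segment with finite abscissa. *)
Definition finite_part s : set (R * R) :=
  match s with
  | Vertical a y0 y1 => [set z | Some z.1 = a /\ (y0 <= z.2%:E <= y1)%E]
  | Horizontal y a b w => [set z | arc a b w z.1 /\ z.2 = y]
  end.

Definition path_part p : set (R * R) :=
  \big[setU/set0]_(s <- p) finite_part s.

(* The colour changes across every interior point (i.e. not an endpoint) of
   the segment with finite abscissa. *)
Definition colour_changes s A B : Prop :=
  match s with
  | Vertical a y0 y1 => forall x y : R, Some x = a -> (y0 < y%:E < y1)%E ->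
      \forall e \near 0^'+, A (x - e, y) <-> B (x + e, y)
  | Horizontal y a b w => forall x : R,
      arc a b w x -> Some x <> a -> Some x <> b ->
      \forall e \near 0^'+, A (x, y - e) <-> B (x, y + e)
  end.

(* A and B are the two colour classes: the colour is locally constant off the
   path and changes across each segment; on the path it is arbitrary. *)
Definition path_splits p A B : Prop :=
  [/\ A `|` B = setT, A `&` B = set0,
      forall z : R * R, ~ path_part p z -> \forall w \near z, A w <-> A z
    & foldr (fun s P => colour_changes s A B /\ P) True p].

End StairLikePaths.

Notation plane R := (measurableTypeR R * measurableTypeR R)%type.

Definition lebesgue_measure2 (R : realType) : set (plane R) -> \bar R :=
  (@lebesgue_measure R \x @lebesgue_measure R)%E.

(* Main.v *)
(* Squash the plane to the unit square.  A point x of the cross-polytope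
   sphere |x_0| + ... + |x_t| = 1 encodes a signed partition of the plane: the
   pairs (u, v) = (x_2j, x_(2j+1)) give consecutive horizontal strips of heights
   |u| + |v|, and strip j is cut vertically in the ratio |u| : |v|, its left
   part getting the sign of u and its right part the sign of v (for even t the
   last strip has v = 0, hence is not cut).  The boundary between the two signs
   is a stair-like path with at most t segments.  Replacing x by -x exchanges
   the signs, and the measure of the positive part is continuous in x because
   the measures do not charge lines; so the Borsuk-Ulam theorem in dimension t
   provides an x for which both parts have the same measure for all t measures.

   Borsuk-Ulam itself follows from a parity argument of Ky Fan type: in iterated
   barycentric subdivisions of the cross-polytope, a labelling of the vertices
   by the signed index of a large coordinate of the map would, without
   complementary edges, produce an odd number of t-simplices whose t + 1 labels
   alternate in sign and have distinct absolute values below t. *)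
Require Import Defs.
From mathcomp Require Import all_boot all_order all_algebra.
From mathcomp Require Import all_classical all_reals all_analysis.
From mathcomp Require Import measurable_realfun.
From mathcomp Require Import lra ring zify.
Import Order.TTheory GRing.Theory Num.Theory.
Import numFieldNormedType.Exports.
Local Open Scope classical_set_scope.
Local Open Scope ring_scope.

Set Implicit Arguments.
Unset Strict Implicit.
Unset Printing Implicit Defensive.

(** * Chains modulo 2 and alternating labels *)

(* A chain with coefficients in F_2 is given by a list of simplices, repetitions
   cancelling: two chains are equal when all cochains w agree on them. *)
Definition ev (T : Type) (c : seq (seq T)) (w : seq T -> bool) : bool :=
  \big[addb/false]_(s <- c) w s.

Lemma ev_map (T T' : Type) (f : seq T -> seq T') c w :
  ev (map f c) w = ev c (w \o f).
Proof. exact: big_map. Qed.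

Section Chains.
Variable T : Type.
Implicit Types (s : seq T) (c d : seq (seq T)) (w : seq T -> bool).

Definition chain_eq c d := forall w, ev c w = ev d w.

(** The empty list is a face of every one-vertex simplex, so this is the augmented boundary; modulo
    2 it carries no signs. *)
Fixpoint faces s : seq (seq T) :=
  if s is p :: s' then s' :: map (cons p) (faces s') else [::].

Definition bind c (f : seq T -> seq (seq T)) := flatten (map f c).

Lemma ev_nil w : ev [::] w = false.
Proof. exact: big_nil. Qed.

Lemma ev_cons s c w : ev (s :: c) w = w s (+) ev c w.
Proof. exact: big_cons. Qed.

Lemma ev_cat c d w : ev (c ++ d) w = ev c w (+) ev d w.
Proof. exact: big_cat. Qed.

Lemma ev_bind c f w : ev (bind c f) w = ev c (fun s => ev (f s) w).
Proof. by rewrite /ev /bind big_flatten big_map. Qed.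

Lemma ev_addb c w w' : ev c (fun s => w s (+) w' s) = ev c w (+) ev c w'.
Proof. exact: big_split. Qed.

Lemma ev_false c : ev c (fun=> false) = false.
Proof. exact: big1_eq. Qed.

Lemma ev_faces_cons p s w :
  ev (faces (p :: s)) w = w s (+) ev (faces s) (w \o cons p).
Proof. by rewrite /= ev_cons ev_map. Qed.

(** Each face of codimension two arises twice, once for each order of dropping two vertices. *)
Lemma ev_faces_faces s w : ev (faces s) (fun r => ev (faces r) w) = false.
Proof.
elim: s w => [|p s IHs] w; first exact: ev_nil.
rewrite ev_faces_cons.
transitivity (ev (faces s) w (+)
  ev (faces s) (fun r => w r (+) ev (faces r) (w \o cons p))).
  by congr addb; apply: eq_bigr => r _; exact: ev_faces_cons.
by rewrite ev_addb IHs addbF addbb.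
Qed.

(** The cone formula for boundaries modulo 2, with apex [p]. *)
Lemma bind_faces_cone p c w :
  ev (bind (map (cons p) c) faces) w
  = ev c w (+) ev (bind c faces) (w \o cons p).
Proof.
rewrite !ev_bind ev_map -ev_addb; apply: eq_bigr => s _ /=.
by rewrite ev_cons ev_map.
Qed.

End Chains.

Section MapChain.
Variables (T T' : Type) (f : T -> T').

Lemma faces_map s : faces (map f s) = map (map f) (faces s).
Proof.
elim: s => //= p s ->; congr (_ :: _); rewrite -!map_comp; exact: eq_map.
Qed.

End MapChain.

Lemma mem_faces (T : eqType) (s r : seq T) :
  r \in faces s -> subseq r s /\ size s = (size r).+1.
Proof.
elim: s r => //= p s IHs r; rewrite inE => /predU1P[->|/mapP[q /IHs[qs sq] ->]].
  by split => //; exact: subseq_cons.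
by rewrite /= eqxx sq.
Qed.

Lemma mem_bind (T : eqType) (c : seq (seq T)) f (r : seq T) :
  r \in bind c f -> exists2 s, s \in c & r \in f s.
Proof. by move=> /flattenP[_ /mapP[s sc ->] rs]; exists s. Qed.

Lemma ev_eq_in (T : eqType) (c : seq (seq T)) w w' :
  {in c, w =1 w'} -> ev c w = ev c w'.
Proof.
by move=> ww; rewrite /ev big_seq [RHS]big_seq; apply: eq_bigr => s /ww.
Qed.

(** A face drops a position, [rem] the first occurrence of a value; with repeated vertices the
    results agree only up to order, hence the invariance asked of [w]. *)
Lemma ev_faces_rem (T : eqType) (s : seq T) (w : seq T -> bool) :
    (forall r r', perm_eq r r' -> w r = w r') ->
  ev (faces s) w = \big[addb/false]_(x <- s) w (rem x s).
Proof.
elim: s w => [|p s IHs] w wP; first by rewrite ev_nil big_nil.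
rewrite ev_faces_cons big_cons /= eqxx IHs; last first.
  by move=> r r' rr; apply: wP; rewrite perm_cons.
congr addb; rewrite big_seq [RHS]big_seq; apply: eq_bigr => x xs /=.
case: eqVneq => [->|//]; apply: wP; rewrite perm_sym; exact: perm_to_rem.
Qed.

Lemma ev_faces_perm (T : eqType) (s s' : seq T) (w : seq T -> bool) :
    (forall r r', perm_eq r r' -> w r = w r') ->
  perm_eq s s' -> ev (faces s) w = ev (faces s') w.
Proof.
move=> wP ss; rewrite !ev_faces_rem// (perm_big _ ss) /=.
rewrite big_seq [RHS]big_seq; apply: eq_bigr => x xs'; apply: wP.
have xs : x \in s by rewrite (perm_mem ss).
rewrite -(perm_cons x) -(permPl (perm_to_rem xs)).
by rewrite -(permPr (perm_to_rem xs')).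
Qed.

(** * Parity of alternating faces, after Ky Fan *)

Section Fan.

Local Notation label := (nat * bool)%type.
Implicit Types (s r : seq label) (b : bool).

Definition flip (p : label) : label := (p.1, ~~ p.2).

Definition abs_lt (p q : label) := (p.1 < q.1)%N.

Fixpoint alternates b s :=
  if s is p :: s' then (p.2 == b) && alternates (~~ b) s' else true.

(** Vertices come in an order unrelated to their labels, so alternation is tested on a rearrangement
    with increasing absolute values. *)
Definition alternating b s : bool :=
  `[< exists r, [/\ perm_eq s r, sorted abs_lt r & alternates b r] >].

Definition complementary_free s := {in s, forall p, flip p \notin s}.

Lemma abs_lt_trans : transitive abs_lt.
Proof. by move=> ? ? ?; exact: ltn_trans. Qed.

Lemma abs_lt_irr : irreflexive abs_lt.
Proof. by move=> ?; exact: ltnn. Qed.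

Lemma alternating_perm b s r :
  perm_eq s r -> alternating b s = alternating b r.
Proof.
move=> sr; apply/asboolP/asboolP => -[q [sq q1 q2]]; exists q; split => //.
  by rewrite perm_sym in sr; exact: perm_trans sq.
exact: perm_trans sq.
Qed.

Lemma alternating_sorted b s :
  sorted abs_lt s -> alternating b s = alternates b s.
Proof.
move=> ss; apply/asboolP/idP => [[r [/perm_mem sr rr]]|ab]; last by exists s.
suff -> : s = r by [].
exact: (irr_sorted_eq abs_lt_trans abs_lt_irr).
Qed.

(** Induction on the first sign. If it is [b], dropping [p] contributes [alternates b s], which
    cancels against a term of the induction hypothesis; otherwise only the face without [p] can
    count. *)
Lemma ev_faces_alternates b s :
  ev (faces s) (alternates b) = alternates b s (+) alternates (~~ b) s.
Proof.
elim: s b => [|p s IHs] b; first by rewrite ev_nil.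
rewrite ev_faces_cons /=.
have [pb|pb] := eqVneq p.2 b.
  rewrite pb.
  rewrite (_ : b == ~~ b = false); last by case: (b).
  transitivity (alternates b s (+) ev (faces s) (alternates (~~ b))).
    by congr addb; apply: eq_bigr => r _ /=; rewrite pb eqxx.
  by rewrite IHs negbK /= addbC addbK addbF.
rewrite (_ : p.2 == ~~ b); last by move: pb; case: p.2; case: (b).
rewrite negbK /= -[RHS]addbF; congr addb.
rewrite -[RHS](ev_false (faces s)); apply: eq_bigr => r _ /=.
by rewrite (negbTE pb).
Qed.

Lemma alternating_dup b p s : alternating b (p :: p :: s) = false.
Proof.
apply/asboolP => -[r [pr rs _]].
have := sorted_uniq abs_lt_trans abs_lt_irr rs.
by rewrite -(perm_uniq pr) /= in_cons eqxx.
Qed.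

(* Among the faces of an alternating simplex starting with b exactly one
   alternates starting with b: drop the last vertex; if it starts with ~~ b,
   drop the first one. *)
Lemma ev_faces_alternating b s : complementary_free s ->
  ev (faces s) (alternating b) = alternating b s (+) alternating (~~ b) s.
Proof.
move=> sfree; have P b' := @alternating_perm b'.
have [r sr] : exists r, perm_eq s r /\ sorted (fun p q => (p.1 <= q.1)%N) r.
  exists (sort (fun p q : label => (p.1 <= q.1)%N) s).
  split; first by rewrite perm_sym perm_sort.
  by apply: sort_sorted => p q; exact: leq_total.
case: sr => sr rs; rewrite (ev_faces_perm (P b) sr) !(P _ _ _ sr).
have {sr sfree} rfree : complementary_free r.
  by move=> p; rewrite -(perm_mem sr) => /sfree; rewrite (perm_mem sr).
have [ur|/(uniqPn (0%N, true))] := boolP (uniq r).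
  (* Distinct labels of equal absolute value would be complementary. *)
  have {rs ur} rs : sorted abs_lt r.
    elim: r rs rfree ur => //= p r IHr; case: r IHr => // q r IHr /=.
    move=> /andP[pq qr] rfree /andP[pr ur].
    apply/andP; split; last first.
      apply: IHr => // z zr; have := rfree z; rewrite inE zr orbT => /(_ isT).
      by rewrite inE negb_or => /andP[].
    rewrite /abs_lt ltn_neqAle pq andbT; apply: contraNneq pr => pq1.
    have := rfree p (mem_head _ _); rewrite !inE !negb_or => /and3P[_ + _].
    move: pq1; case: (p) (q) => [p1 []] [q1 []] /= -> //; rewrite ?eqxx //.
  rewrite !alternating_sorted// -ev_faces_alternates; apply: ev_eq_in => q.
  move=> /mem_faces[qr _]; apply: alternating_sorted.
  exact: (subseq_sorted abs_lt_trans qr).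
(* A label [p] occurs twice: the two faces that drop one copy cancel, and every other face keeps
   both copies, so it cannot alternate. *)
move=> [i [j [ij jr rij]]].
pose p := nth (0%N, true) r i.
have [q rq] : exists q, perm_eq r (p :: p :: q).
  exists (rem p (rem p r)).
  have pr : p \in r by apply: mem_nth; exact: ltn_trans jr.
  apply: (perm_trans (perm_to_rem pr)); rewrite perm_cons.
  apply: perm_to_rem.
  rewrite -has_pred1 has_count count_rem pr /= eqxx subn_gt0.
  rewrite -(cat_take_drop j r) count_cat.
  apply: (@leq_add 1 1); rewrite -has_count has_pred1.
    rewrite /p -(nth_take _ ij); apply: mem_nth.
    by rewrite size_takel// ltnW.
  by rewrite /p rij (drop_nth (0%N,true) jr) mem_head.
rewrite (ev_faces_perm (P b) rq) !(P _ _ _ rq) !alternating_dup.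
rewrite !ev_faces_cons /= addbA addbb /=.
rewrite -[RHS](ev_false (faces q)); apply: eq_bigr => z _ /=.
exact: alternating_dup.
Qed.

Lemma alternating_flip b s :
  alternating b (map flip s) = alternating (~~ b) s.
Proof.
have flipK : involutive flip by case=> l e; rewrite /flip /= negbK.
have half b' s' : alternating (~~ b') s' -> alternating b' (map flip s').
  move=> /asboolP[r [sr rs ar]]; apply/asboolP; exists (map flip r); split.
  - exact: perm_map.
  - rewrite sorted_map; apply: sub_sorted rs => p q //.
  elim: r {sr rs} b' ar => //= p r IHr b' /andP[/eqP pb /IHr ->].
  by rewrite pb negbK eqxx.
apply/idP/idP => [|/half //] h.
rewrite -(mapK flipK s); apply: half; by rewrite negbK.
Qed.

Lemma alternating_size n b s :
  alternating b s -> all (fun p => (p.1 < n)%N) s -> (size s <= n)%N.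
Proof.
move=> /asboolP[r [sr rs _]]; rewrite (perm_all _ sr) (perm_size sr) => rn.
rewrite -(size_map fst) -(size_iota 0 n); apply: uniq_leq_size.
  apply: (sorted_uniq ltn_trans ltnn); rewrite sorted_map.
  by apply: sub_sorted rs.
by move=> l /mapP[p /(allP rn) pn ->]; rewrite mem_iota.
Qed.

End Fan.

(** * Complementary edges in antipodal chains *)

Section AntipodalChains.
Variables (T : eqType) (opp : T -> T) (lab : T -> nat * bool).

Definition antipode (c : seq (seq T)) := map (map opp) c.

(* The chain c k plays the role of a k-dimensional hemisphere: its boundary
   consists of two antipodal (k-1)-dimensional hemispheres. *)
Lemma complementary_edge (c : nat -> seq (seq T)) (v : T) n :
    c 0%N = [:: [:: v]] ->
    (forall k, (k < n)%N ->
       chain_eq (bind (c k.+1) (@faces T)) (c k ++ antipode (c k))) ->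
    (forall s, s \in c n -> size s = n.+1) ->
    (forall k s p, (k <= n)%N -> s \in c k -> p \in s ->
       lab (opp p) = flip (lab p) /\ ((lab p).1 < n)%N) ->
  exists k s p q, [/\ (k <= n)%N, s \in c k, p \in s, q \in s
    & lab q = flip (lab p)].
Proof.
move=> c0 cS csize cP; apply/not_existsP => noedge.
have cfree k s : (k <= n)%N -> s \in c k -> complementary_free (map lab s).
  move=> kn sc _ /mapP[p ps ->]; apply/mapP => -[q qs qp].
  apply: (noedge k); exists s, p, q; split => //.
pose W b s := alternating b (map lab s).
have Wd k b : (k <= n)%N ->
    ev (bind (c k) (@faces T)) (W b) = ev (c k) (W b) (+) ev (c k) (W (~~ b)).
  move=> kn; rewrite ev_bind -ev_addb; apply: ev_eq_in => s sc.
  rewrite -ev_faces_alternating; last exact: cfree sc.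
  by rewrite faces_map ev_map.
(* By [Wd] the sum for [c k.+1] is the parity of the boundary simplices alternating from [true].
   These lie in [c k] or its antipode, and flipping labels turns the antipodal ones into simplices
   of [c k] alternating from [false]. *)
have Wodd k : (k <= n)%N -> ev (c k) (W true) (+) ev (c k) (W false).
  elim: k => [_|k IHk kn].
    rewrite c0 !ev_cons !ev_nil !addbF /W /= !alternating_sorted//=.
    by case: (lab v).2.
  rewrite -(Wd _ true)// cS// ev_cat ev_map.
  rewrite (_ : ev _ (_ \o _) = ev (c k) (W false)); first exact/IHk/ltnW.
  apply: ev_eq_in => s sc /=.
  rewrite /W -[false]/(~~ true) -alternating_flip -!map_comp.
  congr alternating; apply/eq_in_map => p ps /=.
  by case: (cP k s p (ltnW kn) sc ps).
have [b [s sc]] : exists b, exists2 s, s \in c n & W b s.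
  have [//|/hasPn h] := boolP (has (fun s => W true s || W false s) (c n)).
    by move=> /hasP[s sc /orP[|] ?]; [exists true|exists false]; exists s.
  have := Wodd n (leqnn n); rewrite (@ev_eq_in _ _ _ (fun=> false)).
    rewrite (@ev_eq_in _ _ (W false) (fun=> false)) ?ev_false//.
    by move=> s /h; rewrite negb_or => /andP[_ /negbTE].
  by move=> s /h; rewrite negb_or => /andP[/negbTE].
(* The labels of [s] would have n + 1 distinct absolute values below n. *)
have sn : all (fun p => (p.1 < n)%N) (map lab s).
  by apply/allP => _ /mapP[p ps ->]; case: (cP n s p _ sc ps).
by move=> /alternating_size/(_ sn); rewrite size_map csize// ltnn.
Qed.

End AntipodalChains.

(** * Barycentric subdivision *)

Section Subdivision.
Variables (R : realType) (E : normedModType R).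
Implicit Types (s : seq E) (c d : seq (seq E)) (Q : set E) (D : R).

Definition barycentre s : E := (size s)%:R^-1 *: \sum_(p <- s) p.

(** The subdivided boundary is coned off from the barycentre; [k] is fuel, to be the size of [s],
    because passing to faces is not structural recursion. *)
Fixpoint sd_rec k s : seq (seq E) :=
  if k is k'.+1 then map (cons (barycentre s)) (bind (faces s) (sd_rec k'))
  else [:: s].

Definition sd s := sd_rec (size s) s.

Lemma sd_cons p s :
  sd (p :: s) = map (cons (barycentre (p :: s))) (bind (faces (p :: s)) sd).
Proof.
rewrite /sd [LHS]/=; congr (map _ (flatten _)).
by apply/eq_in_map => r /(@mem_faces _ (p :: s))[_ [->]].
Qed.

(** By the cone formula the boundary of [sd s] is the subdivided boundary of [s] plus a cone over
    the boundary of the latter, which by induction is the subdivision of a double boundary and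
    vanishes. *)
Lemma ev_sd_faces s w :
  ev (bind (sd s) (@faces E)) w = ev (bind (faces s) sd) w.
Proof.
have [n] := ubnP (size s); elim: n s w => // n IHn [|p s] w sn.
  by rewrite /sd /= /bind /= ev_nil.
rewrite sd_cons bind_faces_cone; set b := barycentre _.
rewrite (_ : ev (bind (bind _ _) _) _ = false) ?addbF// !ev_bind.
rewrite -[RHS](ev_faces_faces (p :: s) (fun q => ev (sd q) (w \o cons b))).
apply: ev_eq_in => r /mem_faces[_ [sr]]; rewrite -!ev_bind; apply: IHn.
by rewrite -sr.
Qed.

Definition sdc c := bind c sd.

Lemma sdc_chain_eq c d : chain_eq c d -> chain_eq (sdc c) (sdc d).
Proof. by move=> cd w; rewrite !ev_bind; exact: cd. Qed.

Lemma faces_sdc c :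
  chain_eq (bind (sdc c) (@faces E)) (sdc (bind c (@faces E))).
Proof.
move=> w; rewrite !ev_bind; apply: eq_bigr => s _.
by rewrite -!ev_bind ev_sd_faces.
Qed.

Lemma barycentreN s : barycentre (map -%R s) = - barycentre s.
Proof. by rewrite /barycentre size_map big_map sumrN scalerN. Qed.

Lemma sdN s : sd (map -%R s) = map (map -%R) (sd s).
Proof.
have [n] := ubnP (size s); elim: n s => // n IHn [|p s] sn //.
rewrite -[map _ (p :: s)]/(- p :: map -%R s) !sd_cons.
rewrite -[- p :: map -%R s]/(map -%R (p :: s)) faces_map barycentreN.
rewrite /bind -!map_comp map_flatten map_flatten -!map_comp.
congr flatten; apply/eq_in_map => r /mem_faces[_ [sr]] /=.
rewrite IHn -?sr// -!map_comp; exact: eq_map.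
Qed.

Lemma sdc_antipode c : sdc (antipode -%R c) = antipode -%R (sdc c).
Proof.
rewrite /sdc /bind /antipode map_flatten -!map_comp; congr flatten.
by apply: eq_map => s /=; exact: sdN.
Qed.

Lemma sdc_cat c d : sdc (c ++ d) = sdc c ++ sdc d.
Proof. by rewrite /sdc /bind map_cat flatten_cat. Qed.

Lemma size_sd s r : r \in sd s -> size r = size s.
Proof.
have [n] := ubnP (size s); elim: n s r => // n IHn [|p s] r sn.
  by rewrite inE => /eqP ->.
rewrite sd_cons => /mapP[q /mem_bind[z /mem_faces[_ zs] qz] ->] /=.
by rewrite (IHn _ _ _ qz) -?zs//; move: zs => [<-].
Qed.

(** The one consequence of convexity that subdivision calls for. *)
Definition barycentre_closed Q :=
  forall s, s != [::] -> (forall p, p \in s -> Q p) -> Q (barycentre s).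

Lemma sd_closed Q s : barycentre_closed Q -> (forall p, p \in s -> Q p) ->
  forall r, r \in sd s -> forall p, p \in r -> Q p.
Proof.
move=> Qb; have [n] := ubnP (size s); elim: n s => // n IHn [|p s] sn Qs r.
  by rewrite inE => /eqP ->.
rewrite sd_cons => /mapP[q /mem_bind[z /mem_faces[zs' zs] qz] ->] v.
rewrite inE => /predU1P[->|]; first exact: Qb.
apply: (IHn z) => //; first by move: zs => [<-].
by move=> u /(mem_subseq zs'); exact: Qs.
Qed.

Lemma barycentre_dist s q : s != [::] ->
  `|barycentre s - q| <= (size s)%:R^-1 * \sum_(p <- s) `|p - q|.
Proof.
move=> s0; have s_gt0 : 0 < (size s)%:R :> R by rewrite ltr0n lt0n size_eq0.
rewrite (_ : _ - q = (size s)%:R^-1 *: \sum_(p <- s) (p - q)).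
  rewrite normrZ (ger0_norm (_ : 0 <= (size s)%:R^-1)) ?invr_ge0//.
  apply: ler_wpM2l; first by rewrite invr_ge0.
  exact: ler_norm_sum.
rewrite big_split /= scalerDr; congr (_ + _).
rewrite sumrN big_const_seq count_predT iter_addr_0 scalerN -[q *+ _]scaler_nat.
by rewrite scalerA mulVf ?scale1r// gt_eqF.
Qed.

Lemma barycentre_closed_ball q D : barycentre_closed [set p | `|p - q| <= D].
Proof.
move=> s s0 sD /=; apply: (le_trans (barycentre_dist _ s0)).
rewrite ler_pdivrMl ?ltr0n ?lt0n ?size_eq0//.
rewrite (le_trans (_ : _ <= \sum_(p <- s) D))//.
  by rewrite big_seq [leRHS]big_seq; exact: ler_sum.
by rewrite big_const_seq count_predT iter_addr_0 mulr_natl.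
Qed.

Definition spread_le D s := forall p q, p \in s -> q \in s -> `|p - q| <= D.

(** Averaging the distances from [u] to m vertices, the term of [u] itself is 0, which leaves the
    factor (m - 1)/m, at most n/(n + 1). *)
Lemma barycentre_spread n D s u : (size s <= n.+1)%N -> spread_le D s ->
  u \in s -> `|u - barycentre s| <= n%:R / n.+1%:R * D.
Proof.
move=> sn sD us; have s0 : s != [::] by case: (s) us.
have D0 : 0 <= D by apply: le_trans (sD u u us us).
rewrite distrC; apply: (le_trans (barycentre_dist _ s0)).
rewrite (perm_big _ (perm_to_rem us)) big_cons /= subrr normr0 add0r.
rewrite (le_trans (_ : _ <= (size s)%:R^-1 * \sum_(v <- rem u s) D))//.
  apply: ler_wpM2l; first by rewrite invr_ge0.
  rewrite big_seq [leRHS]big_seq; apply: ler_sum => v /mem_rem vs.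
  exact: sD.
rewrite big_const_seq count_predT iter_addr_0 size_rem//.
rewrite -[D *+ _]mulr_natl mulrA.
apply: ler_wpM2r => //.
move: us sn; case: (s) => //= _ r _; rewrite ltnS => rn.
rewrite mulrC ler_pdivrMr// mulrAC ler_pdivlMr// -!natrM ler_nat.
by rewrite mulnS [(n * _)%N]mulnS mulnC leq_add2r.
Qed.

(** Two vertices other than the new barycentre belong to the subdivision of one face, where
    induction applies; the barycentre is near all vertices of [s], hence near everything in the ball
    containing them. *)
Lemma sd_spread n D s r : (size s <= n.+1)%N -> spread_le D s -> r \in sd s ->
  spread_le (n%:R / n.+1%:R * D) r.
Proof.
set rho := n%:R / n.+1%:R.
have [m] := ubnP (size s); elim: m s r => // m IHm [|p s] r sm sn sD.
  by rewrite inE => /eqP ->.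
have D0 : 0 <= D by apply: le_trans (sD p p (mem_head _ _) (mem_head _ _)).
have rhoD0 : 0 <= rho * D by rewrite !mulr_ge0// invr_ge0.
rewrite sd_cons; set b := barycentre _.
move=> /mapP[q /mem_bind[z /mem_faces[zs' zs] qz] ->].
have bs u : u \in p :: s -> `|u - b| <= rho * D.
  exact: barycentre_spread.
have bq u : u \in q -> `|u - b| <= rho * D.
  apply: (sd_closed (@barycentre_closed_ball b (rho * D)) _ qz).
  by move=> v /(mem_subseq zs'); exact: bs.
have qD : spread_le (rho * D) q.
  apply: (IHm z) => //; first by move: zs => [<-].
    by apply: leq_trans sn; rewrite zs.
  by move=> u v /(mem_subseq zs') us /(mem_subseq zs') vs; exact: sD.
move=> u v; rewrite !inE => /predU1P[->|uq] /predU1P[->|vq].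
- by rewrite subrr normr0.
- by rewrite distrC; exact: bq.
- exact: bq.
- exact: qD.
Qed.

End Subdivision.

(** * The Borsuk-Ulam theorem *)

Section BorsukUlam.
Variables (R : realType) (n : nat).
Local Notation E := 'rV[R]_n.+1.
Implicit Types (s : seq E) (x : E) (sigma : nat -> bool).

Definition l1norm x : R := \sum_i `|x 0 i|.

Definition vertex (k : nat) : E := delta_mx 0 (inord k).

(** The half of the k-dimensional cross-polytope sphere on the side of the positive vertex
    [vertex k], as a cone over the sphere one dimension lower. *)
Fixpoint hemisphere k : seq (seq E) :=
  if k is k'.+1 then
    map (cons (vertex k)) (hemisphere k' ++ antipode -%R (hemisphere k'))
  else [:: [:: vertex 0]].

Lemma ev_faces_antipode (c : seq (seq E)) w :
  ev (bind (antipode -%R c) (@faces E)) w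
  = ev (bind c (@faces E)) (w \o map -%R).
Proof.
rewrite !ev_bind ev_map; apply: eq_bigr => s _ /=.
by rewrite faces_map ev_map.
Qed.

(** By the cone formula it remains to see that the base sphere has no boundary: its two antipodal
    halves have the same one modulo 2. *)
Lemma faces_hemisphere k : chain_eq (bind (hemisphere k.+1) (@faces E))
  (hemisphere k ++ antipode -%R (hemisphere k)).
Proof.
elim: k => [|k IHk] w.
  rewrite /= /bind /= !ev_cons !ev_nil.
  by case: (w [:: vertex 0]); case: (w [:: vertex 1]); case: (w _).
have -> : hemisphere k.+2 = map (cons (vertex k.+2))
  (hemisphere k.+1 ++ antipode -%R (hemisphere k.+1)) by [].
rewrite bind_faces_cone -[RHS]addbF; congr addb.
rewrite /bind map_cat flatten_cat ev_cat -!/(bind _ _) ev_faces_antipode.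
rewrite !IHk !ev_cat !ev_map.
rewrite (_ : ev (hemisphere k) 
    (((w \o cons (vertex k.+2)) \o map -%R) \o map -%R) =
  ev (hemisphere k) (w \o cons (vertex k.+2))); last first.
  apply: eq_bigr => s _ /=; congr (w (_ :: _)).
  by rewrite -map_comp map_id_in// => p _ /=; rewrite opprK.
rewrite [X in _ (+) X]addbC; exact: addbb.
Qed.

Lemma size_hemisphere k s : s \in hemisphere k -> size s = k.+1.
Proof.
elim: k s => [|k IHk] s /=; first by rewrite inE => /eqP ->.
move=> /mapP[r + ->] /=; rewrite mem_cat => /orP[/IHk ->//|/mapP[q /IHk qk ->]].
by rewrite size_map qk.
Qed.

Definition signed_vertex sigma i : E := (-1) ^+ sigma i *: vertex i.

(** One [sigma] serves all vertices of a simplex, which places the simplex in a single facet of the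
    cross-polytope. *)
Lemma hemisphere_vertices k s : s \in hemisphere k ->
  exists sigma, forall p, p \in s ->
    exists2 i, (i <= k)%N & p = signed_vertex sigma i.
Proof.
elim: k s => [|k IHk] s /=.
  rewrite inE => /eqP ->; exists (fun=> false) => p; rewrite inE => /eqP ->.
  by exists 0%N => //; rewrite /signed_vertex expr0 scale1r.
move=> /mapP[r rk ->].
have [sigma sr] : exists sigma, forall p, p \in r ->
    exists2 i, (i <= k)%N & p = signed_vertex sigma i.
  move: rk; rewrite mem_cat => /orP[/IHk //|/mapP[q /IHk [sigma sq] ->]].
  exists (fun i => ~~ sigma i) => _ /mapP[p /sq [i ik ->] ->]; exists i => //.
  by rewrite /signed_vertex signrN scaleNr.
(* The new apex is a positive vertex, so signs beyond [k] are reset to plus. *)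
exists (fun i => (i <= k)%N && sigma i) => p.
rewrite inE => /predU1P[->|/sr [i ik ->]].
  by exists k.+1 => //; rewrite /signed_vertex ltnn expr0 scale1r.
by exists i; [exact: leqW|rewrite /signed_vertex ik].
Qed.

(** A facet is convex, unlike the sphere, so subdividing inside it never leaves the sphere. *)
Definition facet sigma : set E :=
  [set x | (forall i : 'I_n.+1, 0 <= (-1) ^+ sigma i * x 0 i) /\
           \sum_(i < n.+1) (-1) ^+ sigma i * x 0 i = 1].

Lemma facet_l1norm sigma x : facet sigma x -> l1norm x = 1.
Proof.
move=> [x0 <-]; apply: eq_bigr => i _.
by rewrite -(ger0_norm (x0 i)) normrM normrX normrN1 expr1n mul1r.
Qed.

Lemma facet_signed_vertex sigma k :
  (k <= n)%N -> facet sigma (signed_vertex sigma k).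
Proof.
move=> kn.
have coordE (i : 'I_n.+1) : (-1) ^+ sigma i * signed_vertex sigma k 0 i =
    (i == inord k :> 'I_n.+1)%:R :> R.
  rewrite !mxE eqxx /=; case: eqVneq => [->|]; last by rewrite !mulr0.
  by rewrite inordK// mulr1 -expr2 sqrr_sign.
split; first by move=> i; rewrite coordE.
rewrite (bigD1 (inord k)) //= coordE eqxx big1 ?addr0// => i /negbTE ik.
by rewrite coordE ik.
Qed.

Lemma barycentre_closed_facet sigma : barycentre_closed (facet sigma).
Proof.
move=> s s0 sP.
have s_gt0 : 0 < (size s)%:R :> R by rewrite ltr0n lt0n size_eq0.
have coordE (i : 'I_n.+1) : (-1) ^+ sigma i * barycentre s 0 i =
    (size s)%:R^-1 * \sum_(p <- s) (-1) ^+ sigma i * p 0 i.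
  by rewrite !mxE summxE -mulr_sumr mulrCA.
split=> [i|].
  rewrite coordE mulr_ge0 ?invr_ge0// big_seq sumr_ge0// => p /sP[+ _].
  exact.
under eq_bigr do rewrite coordE.
rewrite -mulr_sumr exchange_big /= big_seq.
rewrite (eq_bigr (fun=> 1)) => [|p /sP[_ ->]//].
rewrite -big_seq big_const_seq count_predT iter_addr_0 mulVf//.
by rewrite gt_eqF.
Qed.

Lemma mx_norm_le_l1norm x : `|x| <= l1norm x.
Proof.
rewrite [leLHS]mx_normrE; apply/bigmax_leP; split.
  by apply: sumr_ge0.
move=> [i j] _ /=; rewrite ord1 /l1norm (bigD1 j)//= lerDl.
exact: sumr_ge0.
Qed.

Definition subdivided m k := iter m (@sdc R E) (hemisphere k).

Lemma subdivided_facet m k s : (k <= n)%N -> s \in subdivided m k ->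
  exists sigma, forall p, p \in s -> facet sigma p.
Proof.
move=> kn; elim: m s => [|m IHm] s.
  move=> /hemisphere_vertices[sigma sP]; exists sigma => p /sP[i ik ->].
  by apply: facet_signed_vertex; exact: leq_trans kn.
move=> /mem_bind[r /IHm[sigma rP] rs]; exists sigma.
exact: (sd_closed (@barycentre_closed_facet sigma) rP rs).
Qed.

Lemma size_subdivided m k s : s \in subdivided m k -> size s = k.+1.
Proof.
elim: m s => [|m IHm] s; first exact: size_hemisphere.
by move=> /mem_bind[r /IHm <- /size_sd].
Qed.

(** Each round contracts by the ratio of [sd_spread]; the initial 2 bounds the distance of two
    points of norm at most 1. *)
Lemma subdivided_spread m k s : (k <= n)%N -> s \in subdivided m k ->
  spread_le ((n%:R / n.+1%:R) ^+ m * 2) s.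
Proof.
move=> kn; elim: m s => [|m IHm] s sk.
  have [sigma sP] := subdivided_facet kn sk.
  have s1 p : p \in s -> `|p| <= 1.
    by move=> /sP/facet_l1norm <-; exact: mx_norm_le_l1norm.
  move=> p q ps qs; rewrite expr0 mul1r (le_trans (ler_normB _ _))//.
  by rewrite -[2]/(1 + 1) lerD// s1.
have [r rk rs] := mem_bind sk.
rewrite exprS -mulrA; apply: (sd_spread _ _ rs); last exact: IHm.
by rewrite (size_subdivided rk).
Qed.

Lemma subdivided0 m : subdivided m 0 = [:: [:: vertex 0]].
Proof.
elim: m => // m; rewrite /subdivided /= => ->.
rewrite /sdc /bind /= /sd /= /barycentre /= big_seq1 invr1 scale1r.
by [].
Qed.

Lemma subdivided_faces m k : chain_eq (bind (subdivided m k.+1) (@faces E))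
  (subdivided m k ++ antipode -%R (subdivided m k)).
Proof.
elim: m => [|m IHm]; first exact: faces_hemisphere.
move=> w; rewrite /subdivided /= faces_sdc (sdc_chain_eq IHm).
by rewrite sdc_cat sdc_antipode.
Qed.

Lemma l1norm_continuous : continuous l1norm.
Proof.
apply: (@continuous_big R) => [|i _ x]; first exact: add_continuous.
apply: (@continuous_comp _ _ _ (fun y : E => y 0 i) (@Num.norm R R)).
  exact: coord_continuous.
exact: norm_continuous.
Qed.

Lemma compact_sphere : compact [set x : E | l1norm x = 1].
Proof.
apply: bounded_closed_compact.
  exists 1; split => // M M1 x /= x1.
  by rewrite (le_trans (mx_norm_le_l1norm x))// x1 ltW.
rewrite (_ : mkset _ = l1norm @^-1` [set 1]); last by [].
by apply: closed_comp => [x _|]; [exact: l1norm_continuous|exact: closed_eq].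
Qed.

Theorem borsuk_ulam (F : 'I_n -> E -> R) :
    (forall i, continuous (F i)) -> (forall i x, F i (- x) = - F i x) ->
  exists2 x, l1norm x = 1 & forall i, F i x = 0.
Proof.
move=> Fc Fodd; apply: contrapT => /forall2NP nozero.
pose K := [set x : E | l1norm x = 1].
have cK : near_covering K.
  by apply/compact_near_coveringP; exact: compact_sphere.
(* Compactness makes the absence of common zeros uniform. *)
have [d [d0 Kd]] : exists d : R, 0 < d /\
    K `<=` [set x | exists i, d < `|F i x|].
  near (0 : R)^'+ => d; exists d; split; first by near: d; exact: nbhs_right_gt.
  near: d; apply: (cK _ _ (fun d x => exists i, d < `|F i x|)) => x Kx.
  have [i Fix] : exists i, F i x != 0.
    by case: (nozero x) => // /existsNP[i /eqP ?]; exists i.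
  have F0 : 0 < `|F i x| by rewrite normr_gt0.
  near=> y d => /=; exists i; apply: (@lt_trans _ _ (`|F i x| / 2)).
    by near: d; apply: nbhs_right_lt; rewrite divr_gt0.
  near: y; apply: (cvgr_gt (`|F i x|)); last first.
    by rewrite ltr_pdivrMr// ltr_pMr// ltr1n.
  by apply: cvg_norm; exact: Fc.
(* Uniform continuity on the sphere, with tolerance [d]. *)
have [e [e0 Ke]] : exists e : R, 0 < e /\ K `<=` [set x | forall y, K y ->
    `|x - y| < e -> forall i, `|F i x - F i y| < d].
  near (0 : R)^'+ => e; exists e; split; first by near: e; exact: nbhs_right_gt.
  near: e; apply: (cK _ _ (fun e x => forall y, K y -> `|x - y| < e ->
    forall i, `|F i x - F i y| < d)) => x Kx.
  have d2 : 0 < d / 2 by rewrite divr_gt0.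
  have [r r0 xr] : exists2 r : R, 0 < r & forall y, `|x - y| < r ->
      forall i, `|F i x - F i y| < d / 2.
    have : \forall y \near x, forall i, `|F i x - F i y| < d / 2.
      have Fi i : \forall y \near x, `|F i x - F i y| < d / 2.
        exact: (cvgr_dist_lt (F i) _ (Fc i x) _ d2).
      exact: (filter_forall _ Fi).
    move=> /nbhs_ballP[r /= r0 xr]; exists r => // y xy; apply: xr.
    by rewrite -ball_normE.
  have r2 : 0 < r / 2 by rewrite divr_gt0.
  have xr2 : \forall y \near x, `|x - y| < r / 2.
    by have := nbhsx_ballx x _ r2; rewrite -ball_normE.
  near=> y e.
  have er : e < r / 2 by near: e; exact: nbhs_right_lt.
  have xy : `|x - y| < r / 2 by near: y; exact: xr2.
  move=> z Kz yz i.
  rewrite (splitr d) -(subrKA (F i x)).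
  rewrite (le_lt_trans (ler_normD _ _))// ltrD//.
    rewrite distrC; apply: xr.
    by rewrite (lt_trans xy)// ltr_pdivrMr// ltr_pMr// ltr1n.
  apply: xr; rewrite (splitr r) -(subrKA y).
  rewrite (le_lt_trans (ler_normD _ _))// ltrD//.
  exact: lt_trans er.
(* On [K] the default [(0, true)] never occurs, by [Kd]. The index depends only on the test
   [d < |F i x|], which is the same at [x] and [- x], so antipodes share it. *)
pose lab x : nat * bool :=
  if [pick i | d < `|F i x|] is Some i then (val i, 0 < F i x) else (0%N, true).
have labP x : K x -> exists i : 'I_n,
    [/\ lab x = (val i, 0 < F i x), d < `|F i x| & lab (- x) = flip (lab x)].
  move=> /Kd[j xj]; rewrite /lab.
  rewrite (@eq_pick _ (fun i => d < `|F i (- x)|) (fun i => d < `|F i x|));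
    last first.
    by move=> i /=; rewrite Fodd normrN.
  case: pickP => [i xi|/(_ j)]; last by rewrite xj.
  exists i; split => //; rewrite /flip Fodd oppr_gt0 -leNgt le_eqVlt.
  by rewrite -normr_eq0 gt_eqF// (lt_trans d0).
have [m me] : exists m, (n%:R / n.+1%:R) ^+ m * 2 < e.
  have rho1 : `|n%:R / n.+1%:R : R| < 1.
    by rewrite ger0_norm ?divr_ge0// ltr_pdivrMr// mul1r ltr_nat.
  have e2 : 0 < e / 2 by rewrite divr_gt0.
  have [m _ /(_ m (leqnn m))] := cvgr_dist_lt _ _ (cvg_expr rho1) _ e2.
  rewrite /= sub0r normrN => me; exists m; rewrite -ltr_pdivlMr//.
  exact: le_lt_trans (ler_norm _) me.
have subK k s p : (k <= n)%N -> s \in subdivided m k -> p \in s -> K p.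
  by move=> kn /(subdivided_facet kn)[sigma sP] /sP; exact: facet_l1norm.
have [||||k [s [p [q [kn sk ps qs pq]]]]] :=
  @complementary_edge _ -%R lab (subdivided m) (vertex 0) n.
- exact: subdivided0.
- by move=> k kn; exact: subdivided_faces.
- by move=> s /size_subdivided.
- move=> k s p kn sk ps; have [i [-> _ ->]] := labP _ (subK _ _ _ kn sk ps).
  by split => //=.
(* At the ends of the edge one component has opposite signs and absolute values above [d], so it
   varies by more than [d] although the ends are closer than [e]. *)
have [Kp Kq] := (subK _ _ _ kn sk ps, subK _ _ _ kn sk qs).
have [i [lp dp _]] := labP _ Kp; have [j [lq dq _]] := labP _ Kq.
have pqe : `|p - q| < e.
  by apply: le_lt_trans me; exact: (subdivided_spread kn sk).
have := Ke _ Kp _ Kq pqe i.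
move: pq; rewrite lp lq => -[/val_inj ji]; rewrite ji in dq *.
have [Fp|Fp] := ltP 0 (F i p) => /=.
  move=> /negbT; rewrite -leNgt => Fq; apply/negP; rewrite -leNgt.
  rewrite gtr0_norm // in dp; rewrite ler0_norm// in dq.
  rewrite ger0_norm ?subr_ge0 ?(le_trans Fq) ?ltW//.
  by rewrite (lt_le_trans dp)// lerDl oppr_ge0.
move=> Fq; apply/negP; rewrite -leNgt distrC.
rewrite gtr0_norm// in dq; rewrite ler0_norm// in dp.
rewrite ger0_norm ?subr_ge0 ?(le_trans Fp) ?ltW//.
by rewrite (lt_le_trans dq)// lerDl oppr_ge0.
Unshelve. all: by end_near.
Qed.

End BorsukUlam.

(** * Signed partitions of the plane *)

Section Squash.
Variable R : realType.
Implicit Types a : R.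

(** An increasing bijection of the line onto the open unit interval, [contract] being a/(1 +
    |a|). *)
Definition squash (a : R) : R := (1 + contract a%:E) / 2.

Lemma squash_gt0 a : 0 < squash a.
Proof.
rewrite divr_gt0//; have := contract_lt1 a.
by rewrite ltr_norml -ltrBlDl sub0r => /andP[].
Qed.

Lemma squash_lt1 a : squash a < 1.
Proof.
rewrite ltr_pdivrMr// mul1r; have := contract_lt1 a.
by rewrite ltr_norml => /andP[_]; rewrite -(ltrD2l 1).
Qed.

Lemma lt_squash : {mono squash : a b / a < b}.
Proof. by move=> a b; rewrite ltr_pM2r// ltrD2l lt_contract lte_fin. Qed.

Lemma squash_inj : injective squash.
Proof.
move=> a b ab; apply/eqP; rewrite eq_le !leNgt.
by rewrite -(lt_squash a b) -(lt_squash b a) ab ltxx.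
Qed.

Lemma measurable_squash : measurable_fun setT squash.
Proof.
apply: continuous_measurable_fun => a.
have a0 : 1 + `|a| != 0 by rewrite gt_eqF// (lt_le_trans ltr01)// lerDl.
apply: (@continuousM _ _ (fun b : R => 1 + b / (1 + `|b|)) (fun=> 2^-1));
  last exact: cst_continuous.
apply: continuousD; first exact: cst_continuous.
apply: continuousM => //; apply: continuousV => //.
by apply: continuousD; [exact: cst_continuous|exact: norm_continuous].
Qed.

Definition unsquash (b : R) : R := fine (expand (2 * b - 1)).

Lemma unsquashK b : 0 < b < 1 -> squash (unsquash b) = b.
Proof.
move=> /andP[b0 b1]; have b1' : `|2 * b - 1| < 1 by rewrite ltr_norml; lra.
rewrite /squash /unsquash fineK ?expandK ?inE ?ltW//; last first.
  by rewrite fin_numE -!contract_eqN1 -!contract_eq1 expandK ?inE ?ltW//;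
     move: b1'; rewrite ltr_norml => /andP[? ?]; rewrite gt_eqF// lt_eqF.
lra.
Qed.

End Squash.

Section MeasurableLt.
Context d (T : measurableType d) (R : realType).

Lemma measurable_set_lt (f g : T -> R) : measurable_fun setT f ->
  measurable_fun setT g -> measurable [set z | f z < g z].
Proof.
move=> mf mg; rewrite (_ : mkset _ = (g \- f) @^-1` `]0, +oo[).
  rewrite -[X in measurable X]setTI.
  by apply: measurable_funB => //; exact: measurable_itv.
by apply/seteqP; split => z /=; rewrite in_itv/= andbT subr_gt0.
Qed.

Lemma measurable_set_cst (P : Prop) : measurable [set _ : T | P].
Proof.
have [p|p] := pselect P.
  by rewrite (_ : mkset _ = setT)//; apply/seteqP; split.
by rewrite (_ : mkset _ = set0)//; apply/seteqP; split.
Qed.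

End MeasurableLt.

Section NearLt.
Context (T : topologicalType) (R : realType).

Lemma near_lt (f g : T -> R) x : {for x, continuous f} ->
  {for x, continuous g} -> f x < g x -> \forall y \near x, f y < g y.
Proof.
move=> fc gc fg; near=> y; rewrite -subr_gt0; near: y.
apply: (cvgr_gt (g x - f x)); last by rewrite subr_gt0.
exact: cvgB.
Unshelve. all: by end_near. Qed.

End NearLt.

(** * The painted set of a point and its measure *)

Section Painting.
Variables (R : realType) (t : nat).
Local Notation E := 'rV[R]_t.+1.
Implicit Types (x : E) (z : plane R) (i j : nat).

(** For even t the last pair of coordinates is incomplete; the default 0 completes it. *)
Definition coord x i : R := if insub i is Some k then x 0 k else 0.

Definition level x j : R := \sum_(i < j.*2) `|coord x i|.

Definition width x j : R := `|coord x j.*2| + `|coord x j.*2.+1|.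

Definition nstrips := (t./2).+1.

(* Strip number j lies between the heights level x j and level x j.+1 (after
   squashing the plane to the unit square); the part of it to the left of the
   abscissa |u|/(|u|+|v|), where u and v are the coordinates 2j and 2j+1 of x,
   has the sign of u, and the rest the sign of v. *)
Definition painted_strip x j : set (plane R) :=
  [set z | [/\ level x j < squash z.2, squash z.2 < level x j.+1 &
    squash z.1 * width x j < `|coord x j.*2| /\ 0 < coord x j.*2 \/
    `|coord x j.*2| < squash z.1 * width x j /\ 0 < coord x j.*2.+1]].

Definition painted x : set (plane R) :=
  [set z | exists2 j, (j < nstrips)%N & painted_strip x j z].

(** Whole lines are taken instead of segments, since they are null anyway; [width x j != 0] excludes
    the vacuous equation 0 = 0. *)
Definition seam x : set (plane R) :=
  [set z | (exists j, squash z.2 = level x j) \/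
    exists j, width x j != 0 /\ squash z.1 * width x j = `|coord x j.*2|].

Lemma coordN x i : coord (- x) i = - coord x i.
Proof. by rewrite /coord; case: insub => [k|]; rewrite ?mxE ?oppr0. Qed.

Lemma levelN x j : level (- x) j = level x j.
Proof. by apply: eq_bigr => i _; rewrite coordN normrN. Qed.

Lemma widthN x j : width (- x) j = width x j.
Proof. by rewrite /width !coordN !normrN. Qed.

Lemma level0 x : level x 0 = 0.
Proof. exact: big_ord0. Qed.

Lemma levelS x j : level x j.+1 = level x j + width x j.
Proof. by rewrite /level doubleS !big_ord_recr addrA. Qed.

Lemma width_ge0 x j : 0 <= width x j.
Proof. exact: addr_ge0. Qed.

Lemma le_level x : {homo level x : i j / (i <= j)%N >-> i <= j}.
Proof.
apply: homo_leq; [exact: lexx|by move=> a b c; exact: le_trans|].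
by move=> j; rewrite levelS lerDl width_ge0.
Qed.

Lemma level_nstrips x : level x nstrips = l1norm x.
Proof.
rewrite /level /l1norm.
have tn : (t.+1 <= nstrips.*2)%N.
  rewrite /nstrips doubleS ltnS -{1}(odd_double_half t).
  by case: (odd t); rewrite ?add0n ?add1n// leqnSn.
rewrite (bigID (fun i : 'I__ => (i < t.+1)%N)) /= [X in _ + X]big1 ?addr0.
  rewrite -(big_ord_widen _ (fun i => `|coord x i|) tn).
  by apply: eq_bigr => k _; rewrite /coord valK.
by move=> i it; rewrite /coord insubN// normr0.
Qed.

Lemma continuous_coord i : continuous (fun x => coord x i).
Proof.
rewrite /coord; case: insubP => [k _ _|_].
  exact: coord_continuous.
exact: cst_continuous.
Qed.

Lemma norm_coord_continuous i : continuous (fun x => `|coord x i|).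
Proof.
move=> x; apply: (@continuous_comp _ _ _ (fun y => coord y i) (@Num.norm R R)).
  exact: continuous_coord.
exact: norm_continuous.
Qed.

Lemma level_continuous j : continuous (fun x => level x j).
Proof.
apply: (@continuous_big R) => [|i _]; first exact: add_continuous.
exact: norm_coord_continuous.
Qed.

Lemma scaled_width_continuous a j : continuous (fun x => a * width x j).
Proof.
move=> x; apply: (@continuousM R E (fun=> a) (fun y => width y j)).
  exact: cst_continuous.
apply: (@continuousD R _ E (fun y => `|coord y j.*2|)
  (fun y => `|coord y j.*2.+1|)); exact: norm_coord_continuous.
Qed.

Lemma painted_strip_measurable x j : measurable (painted_strip x j).
Proof.
have m1 : measurable_fun setT (fun z : plane R => squash z.1).
  exact: measurableT_comp (@measurable_squash R) measurable_fst.
have m2 : measurable_fun setT (fun z : plane R => squash z.2).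
  exact: measurableT_comp (@measurable_squash R) measurable_snd.
have mw : measurable_fun setT (fun z : plane R => squash z.1 * width x j).
  exact: measurable_funM.
rewrite (_ : painted_strip x j =
   [set z | level x j < squash z.2] `&` [set z | squash z.2 < level x j.+1] `&`
   (([set z | squash z.1 * width x j < `|coord x j.*2|] `&`
      [set z | 0 < coord x j.*2]) `|`
    ([set z | `|coord x j.*2| < squash z.1 * width x j] `&`
      [set z | 0 < coord x j.*2.+1]))).
  apply: measurableI; first by apply: measurableI; exact: measurable_set_lt.
  by apply: measurableU; apply: measurableI;
    [exact: measurable_set_lt|exact: measurable_set_cst|
     exact: measurable_set_lt|exact: measurable_set_cst].
apply/seteqP; split => z /=; first by case.
by move=> [[? ?] ?].
Qed.

Lemma painted_measurable x : measurable (painted x).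
Proof.
rewrite (_ : painted x =
    \bigcup_(j in [set j | (j < nstrips)%N]) painted_strip x j).
  apply: bigcup_measurable => j _; exact: painted_strip_measurable.
by apply/seteqP; split => z [j jn jz]; exists j.
Qed.

(** For fixed [z] the conditions are strict inequalities between continuous functions of [x]. *)
Lemma near_painted_strip x j z :
  painted_strip x j z -> \forall y \near x, painted_strip y j z.
Proof.
have near1 (f g : E -> R) : continuous f -> continuous g -> f x < g x ->
  \forall y \near x, f y < g y by move=> fc gc; exact: (near_lt (fc x) (gc x)).
have cc (a : R) : continuous (fun _ : E => a) by exact: cst_continuous.
move=> [h1 h2 h3].
have {}h1 := near1 _ _ (@level_continuous j) (cc _) h1.
have {}h2 := near1 _ _ (cc _) (@level_continuous j.+1) h2.
have {}h3 : \forall y \near x,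
    squash z.1 * width y j < `|coord y j.*2| /\ 0 < coord y j.*2 \/
    `|coord y j.*2| < squash z.1 * width y j /\ 0 < coord y j.*2.+1.
  case: h3 => -[h3 h4].
    have {}h3 := near1 _ _ (@scaled_width_continuous _ j)
      (@norm_coord_continuous _) h3.
    have {}h4 := near1 _ _ (cc _) (@continuous_coord _) h4.
    by apply: filterS2 h3 h4 => y; left.
  have {}h3 := near1 _ _ (@norm_coord_continuous _)
    (@scaled_width_continuous _ j) h3.
  have {}h4 := near1 _ _ (cc _) (@continuous_coord _) h4.
  by apply: filterS2 h3 h4 => y; right.
by apply: filterS3 h1 h2 h3 => y; split.
Qed.

Lemma near_painted_in x z : painted x z -> \forall y \near x, painted y z.
Proof.
move=> [j jn /near_painted_strip xz]; near=> y; exists j => //; near: y.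
exact: xz.
Unshelve. all: by end_near. Qed.

Lemma painted_disjoint x z : painted x z -> ~ painted (- x) z.
Proof.
move=> [j _ [l1 l2 h]] [k _ []].
rewrite !levelN widthN !coordN normrN !oppr_gt0.
move=> l3 l4.
have jk : j = k.
  apply/eqP; rewrite eqn_leq; apply/andP; split; rewrite leqNgt; apply/negP.
    by move=> /(le_level x) kj; have := lt_le_trans l4 kj; rewrite ltNge ltW.
  by move=> /(le_level x) jk; have := lt_le_trans l2 jk; rewrite ltNge ltW.
subst k; lra.
Qed.

(** The third alternative concerns [x] of norm below 1, whose strips do not fill the square; it is
    there because continuity is proved on the whole space. *)
Lemma painted_cover x z : ~ seam x z ->
  [\/ painted x z, painted (- x) z | level x nstrips < squash z.2].
Proof.
move=> zs; have [|zl] := ltP (level x nstrips) (squash z.2).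
  by constructor 3.
have exj : exists j, squash z.2 <= level x j by exists nstrips.
case: (ex_minnP exj) => j zj jmin.
have {zj} zj : squash z.2 < level x j.
  rewrite lt_neqAle zj andbT; apply/eqP => e; apply: zs; left; by exists j.
case: j zj jmin => [|j] zj jmin.
  by move: zj; rewrite level0 ltNge ltW// squash_gt0.
have jn : (j < nstrips)%N by apply: jmin.
have jz : level x j < squash z.2.
  by rewrite ltNge; apply/negP => /jmin; rewrite ltnn.
have w0 : width x j != 0.
  by apply: contraTN (lt_trans jz zj) => /eqP w; rewrite levelS w addr0 ltxx.
have w_gt0 : 0 < width x j by rewrite lt_neqAle eq_sym w0 width_ge0.
have [zx0 zx1] := (squash_gt0 z.1, squash_lt1 z.1).
have [h|h|h] := ltgtP (squash z.1 * width x j) `|coord x j.*2|; last first.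
- by exfalso; apply: zs; right; exists j.
(* The coordinate that colours the side of [z] is nonzero: a zero one would give its side no room
   inside the unit interval. *)
- have : coord x j.*2.+1 != 0.
    apply: contraTneq h => e; rewrite -leNgt /width e normr0 addr0.
    by rewrite ler_piMl// ltW.
  rewrite neq_lt => /orP[v|v].
    constructor 2; exists j => //; split; rewrite ?levelN//.
    by right; rewrite widthN !coordN normrN oppr_gt0.
  by constructor 1; exists j => //; split => //; right.
- have : coord x j.*2 != 0.
    apply: contraTneq h => e; rewrite -leNgt e normr0 mulr_ge0//; exact: ltW.
  rewrite neq_lt => /orP[v|v].
    constructor 2; exists j => //; split; rewrite ?levelN//.
    by left; rewrite widthN !coordN normrN oppr_gt0.
  by constructor 1; exists j => //; split => //; left.
Qed.

(** The alternatives of [painted_cover] are open in [x], and the last two exclude the first. *)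
Lemma painted_locally_constant x z : ~ seam x z ->
  \forall y \near x, painted y z <-> painted x z.
Proof.
move=> /painted_cover[xz|xz|xz].
- have h := near_painted_in xz.
  by near=> y; split => // _; near: y.
- have h : \forall y \near x, painted (- y) z.
    have h0 := @continuousN R E E id x (@cvg_id _ _).
    exact: (h0 _ (near_painted_in xz)).
  have nx : ~ painted x z by move=> /painted_disjoint.
  near=> y; split => // yz; exfalso; apply: (painted_disjoint yz); near: y.
  exact: h.
- have np y : level y nstrips < squash z.2 -> ~ painted y z.
    move=> yz [j jn [_ + _]]; apply/negP; rewrite -leNgt ltW//.
    by apply: le_lt_trans yz; exact: le_level.
  have h : \forall y \near x, level y nstrips < squash z.2.
    by apply: near_lt => //; [exact: level_continuous|exact: cst_continuous].
  have nx := np _ xz.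
  near=> y; split => // yz; exfalso; apply: (np y) => //; near: y; exact: h.
Unshelve. all: by end_near. 
Qed.

(** As [squash] is injective, the seam lies in countably many axis-parallel lines, each a product
    with a null factor. *)
Lemma seam_null x (mu : probability (plane R) R) :
  mu `<< @lebesgue_measure2 R -> mu.-negligible (seam x).
Proof.
move=> ac.
pose lebesgue2 : {measure set (plane R) -> \bar R} :=
  (@lebesgue_measure R \x @lebesgue_measure R)%E.
have null N : measurable N -> lebesgue_measure2 N = 0%E -> mu.-negligible N.
  move=> mN N0; exists N; split => //.
  have nullN : lebesgue2.-null_set N.
    by move=> A mA AN; exact: (subset_measure0 mA mN AN N0).
  exact: (ac N nullN N mN).
have line (a : R) : measurable [set b : measurableTypeR R | squash b = a] /\
    lebesgue_measure [set b : measurableTypeR R | squash b = a] = 0%E.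
  have [[b ba]|nb] := pselect (exists b, squash b = a).
    have -> : [set c : measurableTypeR R | squash c = a] = [set b].
      by apply/seteqP; split => [c /=|c ->//]; rewrite -ba; exact: squash_inj.
    by rewrite lebesgue_measure_set1; split.
  have -> : [set c : measurableTypeR R | squash c = a] = set0.
    by apply/seteqP; split => // b ba; apply: nb; exists b.
  by rewrite measure0; split.
pose H j := [set: measurableTypeR R] `*` [set b : R | squash b = level x j].
pose V j := [set a : R | squash a = `|coord x j.*2| / width x j] `*`
  [set: measurableTypeR R].
have HV : mu.-negligible (\bigcup_j H j `|` \bigcup_j V j); last first.
  apply: negligibleS HV.
  move=> z [[j zj]|[j [w zj]]]; [left|right]; exists j => //.
  by split => //=; rewrite -zj mulfK.
apply: negligibleU; apply: negligible_bigcup => j; apply: null.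
- by apply: measurableX => //; exact: (line _).1.
- rewrite /lebesgue_measure2 product_measure1E//; last exact: (line _).1.
  by rewrite [X in (_ * X)%E](line _).2 mule0.
- by apply: measurableX => //; exact: (line _).1.
- rewrite /lebesgue_measure2 product_measure1E//; last exact: (line _).1.
  by rewrite [X in (X * _)%E](line _).2 mul0e.
Qed.

Definition mass (mu : probability (plane R) R) x : R := fine (mu (painted x)).

(** Otherwise some sequence tends to [x] with masses staying away; but off the null seam the
    indicators are eventually constant, so dominated convergence applies. *)
Lemma mass_continuous (mu : probability (plane R) R) :
  mu `<< @lebesgue_measure2 R -> continuous (mass mu).
Proof.
move=> ac x; apply/(@cvgrPdist_lt _ R _ (nbhs x)) => e e0.
apply: contrapT => nfar.
have far n : exists y, `|x - y| < n.+1%:R^-1 /\ e <= `|mass mu x - mass mu y|.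
  apply: contrapT => h; apply: nfar.
  apply/nbhs_ballP; exists n.+1%:R^-1 => //= y xy.
  rewrite ltNge; apply/negP => xe; apply: h; exists y; split => //.
  by move: xy; rewrite -ball_normE.
have [y yP] := choice far.
have mE (v : E) : mu (painted v) = (\int[mu]_z (\1_(painted v) z)%:E)%E.
  by rewrite integral_indic ?setIT//; exact: painted_measurable.
have mI (v : E) : measurable_fun setT (fun z => (\1_(painted v) z)%:E : \bar R).
  apply/measurable_EFinP; apply: measurable_indic; exact: painted_measurable.
have [] := @dominated_convergence _ _ _ mu setT measurableT
  (fun n z => (\1_(painted (y n)) z)%:E) (fun z => (\1_(painted x) z)%:E)
  (cst 1%E) (fun n => mI (y n)) (mI x).
- apply: negligibleS (seam_null x ac) => z /= nc.
  apply: contrapT => zs; apply: nc => _.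
  have /nbhs_ballP[r /= r0 xr] := painted_locally_constant zs.
  apply: cvg_near_cst; near=> n.
  have -> // : (\1_(painted (y n)) z : R) = \1_(painted x) z.
  have yx : painted (y n) z <-> painted x z.
    apply: xr; rewrite -ball_normE /=; apply: lt_trans (yP n).1 _.
    by near: n; exact: near_infty_natSinv_lt (PosNum r0).
  by rewrite !indicE; congr (_%:R); congr nat_of_bool; apply/idP/idP;
    rewrite !inE => /yx.
- exact: finite_measure_integrable_cst.
- apply: aeW => z n _; rewrite indicE.
  by case: (_ \in _); rewrite /= lee_fin ?normr1 ?normr0.
move=> _ _; rewrite -mE; under eq_fun do rewrite -mE.
have -> : mu (painted x) = (mass mu x)%:E.
  by rewrite fineK// fin_num_measure//; exact: painted_measurable.
move=> /fine_cvg/cvgrPdist_lt/(_ _ e0)[n _ /(_ n (leqnn n))] /=.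
by apply/negP; rewrite -leNgt; exact: (yP n).2.
Unshelve. all: by end_near. Qed.

(** Borsuk-Ulam applies to the odd map given by the mass of [x] minus that of [- x]. On the sphere
    only the null seam stays unpainted, so the two equal masses add up to 1. *)
Theorem painted_halves (mu : 'I_t -> probability (plane R) R) :
    (forall k, mu k `<< @lebesgue_measure2 R) ->
  exists2 x, l1norm x = 1 & forall k,
    mu k (painted x) = (1 / 2)%:E /\ mu k (painted (- x)) = (1 / 2)%:E.
Proof.
move=> ac.
have [||x x1 xF] :=
  @borsuk_ulam R t (fun k x => mass (mu k) x - mass (mu k) (- x)).
- move=> k x; apply: (@continuousB R _ E (mass (mu k)) (mass (mu k) \o -%R)).
    exact: mass_continuous.
  apply: continuous_comp; first exact: opp_continuous.
  exact: mass_continuous.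
- by move=> k x; rewrite opprK opprB.
exists x => // k.
have mp y : measurable (painted y) := painted_measurable y.
have fp y : mu k (painted y) = (mass (mu k) y)%:E.
  by rewrite fineK// fin_num_measure.
have e : mass (mu k) x + mass (mu k) (- x) = 1.
  apply: EFin_inj; rewrite EFinD -!fp -measureU//; last first.
    by apply/seteqP; split => // z [/painted_disjoint].
  have [N [mN N0 sN]] := seam_null x (ac k).
  rewrite -(@probability_setT _ _ _ (mu k)).
  apply/eqP; rewrite eq_le; apply/andP; split.
    by apply: le_measure; rewrite ?inE//; exact: measurableU.
  rewrite -[leRHS]adde0 -[X in (_ <= _ + X)%E]N0.
  have mU : measurable (painted x `|` painted (- x)) by exact: measurableU.
  apply: le_trans (measureU2 (mu k) mU mN).
  apply: le_measure; rewrite ?inE//; first exact: measurableU.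
  move=> z _; have [zs|/painted_cover[zx|zx|]] := pselect (seam x z).
  - by right; exact: sN.
  - by left; left.
  - by left; right.
  - by rewrite level_nstrips x1 ltNge ltW// squash_lt1.
have := xF k; rewrite !fp => f0.
by split; congr (_%:E); lra.
Qed.

End Painting.

(** * Stair-like paths *)

Section Staircase.
Variable R : realType.
Local Notation cut := (abscissa R * bool)%type.
Implicit Types (ac : cut) (rest : seq (R * cut)) (x y : R) (h : \bar R).

(** [ac.2] is the colour to the left of the cut, or everywhere if the cut is at infinity. *)
Definition cut_colour ac x : bool :=
  if ac.1 is Some a then (x < a) (+) ~~ ac.2 else ac.2.

(** The arc has to cover the abscissas where the two colourings differ: between two finite cuts if
    their left colours agree, outside and hence through infinity if not. Equal abscissas with
    opposite colours take the full circle. *)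
Definition cut_winding ac ac' : winding :=
  match ac.1, ac'.1 with
  | Some a, Some a' =>
      if ac.2 == ac'.2 then if a <= a' then Increasing else Decreasing
      else if a == a' then FullCircle
      else if a < a' then Decreasing else Increasing
  | None, Some _ => if ac.2 == ac'.2 then Decreasing else Increasing
  | Some _, None => if ac.2 == ac'.2 then Increasing else Decreasing
  | None, None => if ac.2 == ac'.2 then Increasing else FullCircle
  end.

Lemma arc_cut_winding ac ac' x : Some x <> ac.1 -> Some x <> ac'.1 ->
  Defs.arc ac.1 ac'.1 (cut_winding ac ac') x <->
  cut_colour ac x != cut_colour ac' x.
Proof.
have neq b : Some x <> Some b :> abscissa R -> (b <= x) = ~~ (x < b).
  by move=> _; rewrite leNgt.
have neq' b : Some x <> Some b :> abscissa R -> (x <= b) = (x < b).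
  move=> xb; rewrite lt_neqAle.
  by case: eqVneq => // xb'; case: xb; rewrite xb'.
case: ac ac' => [[a|] c] [[a'|] c'];
  rewrite /cut_winding /cut_colour /= => xa xa'.
- have pq : a <= a' -> x < a -> x < a' by move=> aa xa1; exact: lt_le_trans aa.
  have qp : a' <= a -> x < a' -> x < a by move=> aa xa1; exact: lt_le_trans aa.
  have [aa|aa|aa] := ltgtP a a'.
  + have pq' := pq (ltW aa).
    case: c; case: c' => /=; rewrite ?(ltW aa) ?(lt_geF aa) /= ?neq// ?neq'//
      ?(rwP orP); move: pq'; clear; case: (x < a); case: (x < a') => //;
      by move=> /(_ isT).
  + have qp' := qp (ltW aa).
    case: c; case: c' => /=; rewrite ?(ltW aa) ?(lt_geF aa) /= ?neq// ?neq'//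
      ?(rwP orP); move: qp'; clear; case: (x < a); case: (x < a') => //;
      by move=> /(_ isT).
  + subst a'; case: c; case: c' => /=; rewrite ?lexx /= ?neq// ?neq'//;
    by case: (x < a).
- case: c; case: c' => /=; rewrite ?neq ?neq'//; by case: (x < a).
- case: c; case: c' => /=; rewrite ?neq ?neq'//; by case: (x < a').
- by case: c; case: c'.
Qed.

Lemma cut_winding_ok ac ac' y :
  segment_ok (Horizontal y ac.1 ac'.1 (cut_winding ac ac')).
Proof.
case: ac ac' => [[a|] c] [[a'|] c']; rewrite /cut_winding /=;
  do 3?case: ifP => //.
Qed.

Lemma near_cut_colour ac x : Some x <> ac.1 ->
  \forall x' \near x, cut_colour ac x' = cut_colour ac x.
Proof.
case: ac => [[a|] c] /= xa; rewrite /cut_colour /=; last by near=> x'.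
have [ax|ax|ax] := ltgtP x a; last by case: xa; rewrite ax.
  have xh : \forall x' \near x, x' < a by exact: lt_nbhsl.
  by near=> x'; rewrite (near xh).
have xh : \forall x' \near x, a < x' by exact: lt_nbhsr.
by near=> x'; rewrite lt_gtF// (near xh).
Unshelve. all: by end_near.
Qed.

(* A final vertical segment at infinity is omitted, which saves a turn. *)
Fixpoint stair h ac rest : seq (segment R) :=
  if rest is (y, ac') :: rest' then
    [:: Vertical ac.1 h y%:E, Horizontal y ac.1 ac'.1 (cut_winding ac ac')
      & stair y%:E ac' rest']
  else if ac.1 is Some _ then [:: Vertical ac.1 h +oo%E] else [::].

(** A path has at least one segment, so a lone vertical one is kept even at infinity. *)
Definition staircase ac rest :=
  if rest is [::] then [:: Vertical ac.1 -oo%E +oo%E] else stair -oo%E ac rest.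

Fixpoint colour ac rest x y : bool :=
  if rest is (y1, ac') :: rest' then
    if y < y1 then cut_colour ac x else colour ac' rest' x y
  else cut_colour ac x.

Fixpoint increasing h rest : bool :=
  if rest is (y, _) :: rest' then (h < y%:E)%E && increasing y%:E rest'
  else true.

(** The preceding horizontal segment [s] is carried along because it is the final one when [stair]
    is empty; it then ends at infinity as required. *)
Lemma stair_path h ac rest (s : segment R) : (h < +oo)%E ->
    increasing h rest -> ~~ is_vertical s -> target s = (ac.1, h) ->
  [/\ all (@segment_ok R) (stair h ac rest),
      path (@consecutive R) s (stair h ac rest)
    & end_ok (last s (stair h ac rest))].
Proof.
elim: rest h ac s => [|[y1 ac'] rest IHrest] h ac s hoo /=.
  case: ac => [[a|] c] /= _ sh ts.
    by rewrite hoo /consecutive (negbTE sh) ts /= !eqxx.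
  by split => //; rewrite /end_ok (negbTE sh) ts.
move=> /andP[y01 inc] sh ts.
have [|? ? ?] := IHrest y1%:E ac'
  (Horizontal y1 ac.1 ac'.1 (cut_winding ac ac')) _ inc isT erefl.
- exact: ltry.
split => //.
- by apply/and3P; split => //; exact: cut_winding_ok.
- by rewrite /consecutive (negbTE sh) ts /= !eqxx.
Qed.

Lemma staircase_path ac rest : increasing -oo%E rest ->
  stair_like_path (staircase ac rest).
Proof.
case: rest => [|[y1 ac'] rest] //= inc.
move: inc => /andP[_ inc].
have [|ok1 ok2 ok3] := @stair_path y1%:E ac' rest
  (Horizontal y1 ac.1 ac'.1 (cut_winding ac ac')) _ inc isT erefl.
  exact: ltry.
apply/and3P; split => //.
  by apply/and3P; split; [exact: ltNyr|exact: cut_winding_ok|exact: ok1].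
by rewrite /consecutive /= !eqxx.
Qed.

Lemma near_pair (z : R * R) (P Q : R -> Prop) (S : R * R -> Prop) :
    (\forall x \near z.1, P x) -> (\forall y \near z.2, Q y) ->
    (forall x y, P x -> Q y -> S (x, y)) ->
  \forall w \near z, S w.
Proof.
move=> zP zQ PQ; exists ([set x | P x], [set y | Q y]) => //.
by move=> [x y] [/=]; exact: PQ.
Qed.

Lemma near_gt_ereal h y : (h < y%:E)%E -> \forall y' \near y, (h < y'%:E)%E.
Proof.
case: h => [r| |] //=; last by move=> _; near=> y'; rewrite ltNyr.
by rewrite lte_fin => ry; near=> y'; rewrite lte_fin; near: y'; exact: lt_nbhsr.
Unshelve. all: by end_near.
Qed.

Lemma colour_bottom ac rest x y h : increasing h rest ->
  (y%:E <= h)%E -> colour ac rest x y = cut_colour ac x.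
Proof.
case: rest => [|[y1 ac'] rest] //= /andP[hy1 _] yh.
by rewrite -lte_fin (le_lt_trans yh hy1).
Qed.

Lemma near_colour_above ac rest y1 : increasing y1%:E rest ->
  \forall y \near y1, forall x, colour ac rest x y = cut_colour ac x.
Proof.
case: rest => [|[y2 ac'] rest] /=; first by move=> _; near=> y.
rewrite lte_fin => /andP[y12 _]; have yh := lt_nbhsl y12.
by near=> y => x; rewrite (near yh).
Unshelve. all: by end_near.
Qed.

Lemma stair_start ac rest x y : increasing y%:E rest -> Some x = ac.1 ->
  path_part (stair y%:E ac rest) (x, y).
Proof.
case: rest => [|[y1 ac'] rest] /= => [_|/andP[yy1 _]] xa.
  by rewrite -xa /path_part big_seq1; split => //=; rewrite lexx leey.
by rewrite /path_part big_cons; left; split => //=; rewrite lexx ltW.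
Qed.

(** [C] follows [colour] only above [h], which lets the induction pass to the part above the next
    horizontal segment. *)
Lemma colour_locally_constant h ac rest (C : R * R -> bool) (z : R * R) :
    increasing h rest -> (h < z.2%:E)%E ->
    (forall x y, (h < y%:E)%E -> C (x, y) = colour ac rest x y) ->
    ~ path_part (stair h ac rest) z ->
  \forall w \near z, C w = C z.
Proof.
elim: rest h ac => [|[y1 ac'] rest IHrest] h ac /=.
  move=> _ hz CE nz.
  have za : Some z.1 <> ac.1.
    move=> za; apply: nz; rewrite /path_part -za big_seq1 /=.
    by split => //; rewrite ltW// leey.
  apply: (near_pair (near_cut_colour za) (near_gt_ereal hz)) => x y xz hy.
  by rewrite (surjective_pairing z) !CE.
move=> /andP[hy1 inc] hz CE.
rewrite /path_part !big_cons => /not_orP[nv /not_orP[nh nr]].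
have za : (z.2 <= y1) -> Some z.1 <> ac.1.
  by move=> zy za; apply: nv; split => //; rewrite ltW.
have Cz : C z = C (z.1, z.2) by rewrite -surjective_pairing.
have [zy|zy|zy] := ltgtP z.2 y1.
- have yh := lt_nbhsl zy.
  apply: (near_pair (P := fun x => cut_colour ac x = cut_colour ac z.1)
    (Q := fun y => (h < y%:E)%E /\ y < y1)).
  + by apply: near_cut_colour; apply: za; exact: ltW.
  + by apply: filterS2 (near_gt_ereal hz) yh => y.
  + by move=> x y xz [hy yy]; rewrite Cz !CE// yy zy.
- apply: (IHrest y1%:E ac') => // x y; rewrite lte_fin => yy.
  by rewrite CE ?(lt_trans hy1)//= ltNge ltW.
(* At the height of the horizontal segment but off its arc, the colours below and above agree. *)
- have za1 : Some z.1 <> ac.1 by apply: za; rewrite zy.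
  have za' : Some z.1 <> ac'.1.
    move=> za'; apply: nr; rewrite -/(path_part _).
    by rewrite (surjective_pairing z) zy; exact: stair_start.
  have ch : cut_colour ac z.1 = cut_colour ac' z.1.
    apply/eqP; apply: contrapT => /negP; rewrite -/(_ != _).
    by move=> /(arc_cut_winding za1 za') ?; apply: nh.
  apply: (near_pair (P := fun x => cut_colour ac x = cut_colour ac z.1 /\
     cut_colour ac' x = cut_colour ac' z.1)
    (Q := fun y => (h < y%:E)%E /\
       forall x, colour ac' rest x y = cut_colour ac' x)).
  + by apply: filterS2 (near_cut_colour za1) (near_cut_colour za') => x.
  + have na := near_colour_above ac' inc; rewrite -zy in na.
    by apply: filterS2 (near_gt_ereal hz) na => y; split.
  + move=> x y [xa xa'] [hy cy]; rewrite Cz !CE// zy ltxx cy.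
    rewrite (colour_bottom _ _ inc) //.
    by case: ifP; rewrite ?xa ?xa'.
Qed.

Lemma near0_lt_sub h y : (h < y%:E)%E ->
  \forall e \near 0^'+, (h < (y - e)%:E)%E.
Proof.
case: h => [r| |] //=; last by move=> _; near=> e; rewrite ltNyr.
rewrite lte_fin => ry; near=> e; rewrite lte_fin ltrBrDr -ltrBrDl.
by near: e; apply: nbhs_right_lt; rewrite subr_gt0.
Unshelve. all: by end_near.
Qed.

Lemma near0_colour_above ac rest y1 : increasing y1%:E rest ->
  \forall e \near 0^'+, forall x, colour ac rest x (y1 + e) = cut_colour ac x.
Proof.
case: rest => [|[y2 ac'] rest] /=; first by move=> _; near=> e.
rewrite lte_fin => /andP[y12 _]; near=> e => x.
have -> // : y1 + e < y2.
by rewrite -ltrBrDl; near: e; apply: nbhs_right_lt; rewrite subr_gt0.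
Unshelve. all: by end_near.
Qed.

(** Crossing a vertical segment reverses the comparison with its abscissa; crossing a horizontal one
    exchanges two cut colours that differ by the choice of winding. *)
Lemma stair_colour_changes h ac rest (C : R * R -> bool) :
    increasing h rest ->
    (forall x y, (h < y%:E)%E -> C (x, y) = colour ac rest x y) ->
  foldr (fun s P => colour_changes s [set z | C z] (~` [set z | C z]) /\ P) True
    (stair h ac rest).
Proof.
elim: rest h ac => [|[y1 ac'] rest IHrest] h ac /=.
  case: ac => [[a|] c] //= _ CE; split => // x y [xa] /andP[hy _].
  near=> e; have e0 : 0 < e by near: e; exact: nbhs_right_gt.
  rewrite !CE// /cut_colour /= xa ltrBlDr ltrDl e0 ltNge lerDl ltW//=.
  exact: iff_sym (rwP negP).
move=> /andP[hy1 inc] CE; split; last split.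
- case: ac CE => [[a|] c] //= CE x y [xa] /andP[hy yy].
  near=> e; have e0 : 0 < e by near: e; exact: nbhs_right_gt.
  rewrite lte_fin in yy.
  rewrite !CE// yy /cut_colour /= xa ltrBlDr ltrDl e0 ltNge lerDl ltW//=.
  exact: iff_sym (rwP negP).
- move=> x xarc xa xa'.
  have cc := (arc_cut_winding xa xa').1 xarc.
  near=> e; have e0 : 0 < e by near: e; exact: nbhs_right_gt.
  have he : (h < (y1 - e)%:E)%E. by near: e; exact: near0_lt_sub.
  have -> : C (x, y1 - e) = cut_colour ac x.
    by rewrite CE//= ltrBlDr ltrDl e0.
  have -> : C (x, y1 + e) = cut_colour ac' x.
    rewrite CE; last by rewrite (lt_trans hy1)// lte_fin ltrDl.
    rewrite ltNge lerDl ltW//=.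
    suff : forall x, colour ac' rest x (y1 + e) = cut_colour ac' x by [].
    by near: e; exact: near0_colour_above.
  by move: cc; case: (cut_colour ac x); case: (cut_colour ac' x).
- apply: IHrest => // x y; rewrite lte_fin => yy.
  by rewrite CE ?(lt_trans hy1)//= ltNge ltW.
Unshelve. all: by end_near.
Qed.

Lemma cut_colour_measurable ac :
  measurable [set z : plane R | cut_colour ac z.1].
Proof.
have mlt (a : R) : measurable [set z : plane R | z.1 < a].
  by apply: measurable_set_lt => //; exact: measurable_fst.
case: ac => [[a|] c]; rewrite /cut_colour/=; last exact: measurable_set_cst.
case: c => /=; first by under eq_set do rewrite addbF.
under eq_set do rewrite addbT.
rewrite (_ : mkset _ = ~` [set z : plane R | z.1 < a]).
  exact: measurableC.
by apply/seteqP; split => z /negP.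
Qed.

Lemma colour_measurable ac rest :
  measurable [set z : plane R | colour ac rest z.1 z.2].
Proof.
elim: rest ac => [|[y1 ac'] rest IHrest] ac; first exact: cut_colour_measurable.
have mlt : measurable [set z : plane R | z.2 < y1].
  by apply: measurable_set_lt => //; exact: measurable_snd.
rewrite (_ : mkset _ =
  ([set z : plane R | z.2 < y1] `&` [set z : plane R | cut_colour ac z.1]) `|`
  (~` [set z : plane R | z.2 < y1] `&`
     [set z : plane R | colour ac' rest z.1 z.2])); last first.
  apply/seteqP; split => z /=.
    by case: ifP => zy; [left|right].
  by move=> [[->]//|[/negP/negbTE ->]].
apply: measurableU; apply: measurableI => //; last exact: measurableC.
exact: cut_colour_measurable.
Qed.

Lemma staircase_splits ac rest : increasing -oo%E rest ->
  path_splits (staircase ac rest) [set z : R * R | colour ac rest z.1 z.2]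
    (~` [set z : R * R | colour ac rest z.1 z.2]).
Proof.
move=> inc; pose C (z : R * R) := colour ac rest z.1 z.2.
have CE x y : (-oo < y%:E)%E -> C (x, y) = colour ac rest x y by [].
have nC (z : R * R) : ~ path_part (stair -oo%E ac rest) z ->
    \forall w \near z, C w <-> C z.
  move=> /(colour_locally_constant inc (ltNyr _) CE) Cz.
  by near=> w; rewrite (near Cz).
split; rewrite ?setUv ?setICr//.
  move=> z nz; apply: nC; apply: contra_not nz.
  (* [staircase] and [stair] differ only by a lone segment at infinity, whose finite part is
     empty. *)
  case: rest {inc C CE} => [|//]; case: ac => [[a|] c] //=.
  by rewrite /path_part big_nil.
move: (stair_colour_changes inc CE); rewrite /C; clear.
by case: rest => //; case: ac => [[a|] c].
Unshelve. all: by end_near.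
Qed.

(** The last abscissa, coerced to a number, counts 1 if finite and 0 at infinity, where the final
    segment is omitted. *)
Lemma size_stair h ac rest :
  size (stair h ac rest) = ((size rest).*2 + (last ac (map snd rest)).1)%N.
Proof.
elim: rest h ac => [|[y1 ac'] rest IHrest] h ac /=; first by case: ac => [[]].
by rewrite IHrest doubleS.
Qed.

End Staircase.

(** * The staircase of a point of the sphere *)

Section CutsOfPoint.
Variables (R : realType) (t : nat).
Local Notation E := 'rV[R]_t.+1.
Implicit Types (x : E) (z : plane R) (i j : nat) (js : seq nat).

(* If u and v do not have opposite signs then the strip is monochromatic. *)
Definition cut_of x j : abscissa R * bool :=
  let: (u, v) := (coord x j.*2, coord x j.*2.+1) in
  if u * v < 0 then (Some (unsquash (`|u| / width x j)), 0 < u)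
  else (None, 0 < u + v).

Definition cuts x js := [seq (unsquash (level x j), cut_of x j) | j <- js].

Lemma cut_of_colour x j z : width x j != 0 ->
  cut_colour (cut_of x j) z.1 =
  let: (u, v) := (coord x j.*2, coord x j.*2.+1) in
  if u * v < 0 then (squash z.1 * width x j < `|u|) (+) ~~ (0 < u)
  else 0 < u + v.
Proof.
move=> w0; rewrite /cut_of.
have w_gt0 : 0 < width x j by rewrite lt_neqAle eq_sym w0 width_ge0.
move: (erefl (width x j)); rewrite {1}/width.
move: (coord x j.*2) (coord x j.*2.+1) => u v uvw.
rewrite /cut_colour; case: ifPn => //= uv.
have u0 : 0 < `|u|.
  by rewrite normr_gt0; apply: contraTneq uv => ->; rewrite mul0r ltxx.
have v0 : 0 < `|v|.
  by rewrite normr_gt0; apply: contraTneq uv => ->; rewrite mulr0 ltxx.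
have r01 : 0 < `|u| / width x j < 1.
  by rewrite divr_gt0//= ltr_pdivrMr// mul1r -uvw ltrDl.
by rewrite -lt_squash unsquashK// ltr_pdivlMr.
Qed.

Lemma painted_strip_width x j z : painted_strip x j z -> width x j != 0.
Proof.
move=> [l1 l2 _]; apply: contraTneq (lt_trans l1 l2) => w.
by rewrite levelS w addr0 ltxx.
Qed.

Lemma painted_strip_colour x j z : painted_strip x j z ->
  cut_colour (cut_of x j) z.1.
Proof.
move=> zx; rewrite cut_of_colour//; last exact: painted_strip_width zx.
case: zx => _ _.
move: (coord x j.*2) (coord x j.*2.+1) (_ * _) => u v a h.
case: ifPn => uv.
  case: h => -[h1 h2]; first by rewrite h1 h2.
  rewrite ltNge ltW//= -leNgt leNgt; apply/negP => u0.
  by move: uv; rewrite ltNge mulr_ge0 ?ltW.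
(* When the product is nonnegative, one positive coordinate makes the other nonnegative and the sum
   positive. *)
rewrite -leNgt in uv; case: h => -[h1 h2].
  rewrite ltr_wpDr// -(pmulr_rge0 _ h2)//.
by rewrite ltr_wpDl// -(pmulr_lge0 _ h2).
Qed.

Lemma painted_stripN_colour x j z : painted_strip (- x) j z ->
  ~~ cut_colour (cut_of x j) z.1.
Proof.
move=> zx; rewrite cut_of_colour//; last first.
  by rewrite -widthN; exact: painted_strip_width zx.
case: zx => _ _; rewrite widthN !coordN normrN !oppr_gt0.
move: (coord x j.*2) (coord x j.*2.+1) (_ * _) => u v a h.
case: ifPn => uv.
  case: h => -[h1 h2]; first by rewrite h1 ltNge ltW.
  rewrite [a < _]ltNge ltW//= negbK ltNge; apply/negP => u0.
  by move: uv; rewrite ltNge (mulr_le0 u0 (ltW h2)).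
rewrite -leNgt in uv; rewrite -leNgt; case: h => -[h1 h2].
  by rewrite (nmulr_rge0 _ h2) in uv; lra.
by rewrite (nmulr_lge0 _ h2) in uv; lra.
Qed.

(** [unsquash] inverts [squash] only on the open unit interval; the strip below keeps the level off
    0, its own strip keeps it off 1. *)
Lemma level_between x j0 j1 : (j0 < j1)%N -> width x j0 != 0 ->
  width x j1 != 0 -> level x j1.+1 <= 1 -> 0 < level x j1 < 1.
Proof.
move=> j01 w0 w1 l1; apply/andP; split.
  apply: lt_le_trans (le_level x j01); rewrite levelS ltr_wpDl//.
    by rewrite -(level0 x) le_level.
  by rewrite lt_neqAle eq_sym w0 width_ge0.
by apply: lt_le_trans l1; rewrite levelS ltrDl lt_neqAle eq_sym w1 width_ge0.
Qed.

Lemma colour_cuts x j0 js j z : path ltn j0 js ->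
    (forall k, k \in j0 :: js -> width x k != 0 /\ level x k.+1 <= 1) ->
    j \in j0 :: js -> level x j < squash z.2 < level x j.+1 ->
  colour (cut_of x j0) (cuts x js) z.1 z.2 = cut_colour (cut_of x j) z.1.
Proof.
elim: js j0 => [|j1 js IHjs] j0 /=; first by move=> _ _; rewrite inE => /eqP ->.
move=> /andP[j01 j1js] jsP jin /andP[l1 l2].
have zE : (z.2 < unsquash (level x j1)) = (squash z.2 < level x j1).
  rewrite -lt_squash unsquashK//.
  have [w0 _] := jsP j0 (mem_head _ _).
  have [|w1 l11] := jsP j1; first by rewrite !inE eqxx orbT.
  exact: level_between j01 w0 w1 l11.
rewrite zE; move: jin; rewrite inE => /predU1P[jj0|jin].
  rewrite jj0 in l2 *.
  by rewrite (lt_le_trans l2)// le_level.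
have j1j : (j1 <= j)%N.
  move: jin; rewrite inE => /predU1P[->//|jjs].
  by rewrite ltnW//; exact: (allP (order_path_min ltn_trans j1js)).
rewrite ltNge (le_trans (le_level x j1j) (ltW l1))/=.
apply: IHjs => //; last by rewrite l1.
by move=> k kjs; apply: jsP; rewrite inE kjs orbT.
Qed.

Lemma increasing_cuts x j0 js : path ltn j0 js ->
    (forall k, k \in j0 :: js -> width x k != 0 /\ level x k.+1 <= 1) ->
  increasing -oo%E (cuts x js).
Proof.
move=> j0js jsP; suff h_incr h : (forall k, k \in js ->
    (h < (unsquash (level x k))%:E)%E) -> increasing h (cuts x js).
  by apply: h_incr => k _; exact: ltNyr.
elim: js j0 j0js jsP h => //= j1 js IHjs j0 /andP[j01 j1js] jsP h hjs.
rewrite hjs ?mem_head//=; apply: (IHjs j1) => //.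
  by move=> k kjs; apply: jsP; rewrite inE kjs orbT.
move=> k kjs; rewrite lte_fin -lt_squash.
have [w0 _] := jsP j0 (mem_head _ _).
have [|w1 l1] := jsP j1; first by rewrite !inE eqxx orbT.
have [|wk lk] := jsP k; first by rewrite !inE kjs !orbT.
have j1k : (j1 < k)%N := allP (order_path_min ltn_trans j1js) _ kjs.
rewrite !unsquashK; last exact: level_between j01 w0 w1 l1.
  apply: lt_le_trans (le_level x j1k); rewrite levelS ltrDl.
  by rewrite lt_neqAle eq_sym w1 width_ge0.
exact: level_between j1k w1 wk lk.
Qed.

(** Empty strips are dropped, as they would repeat a height. *)
Definition strips x := [seq j <- iota 0 (nstrips t) | width x j != 0].

(** With k cuts above the first strip there are at most 2k + 1 segments, which suffices unless t is
    even and all strips occur; then the last cut is at infinity and saves one. *)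
Lemma size_strips x : (0 < t)%N -> l1norm x = 1 ->
  exists j0 js, strips x = j0 :: js /\
    (size (staircase (cut_of x j0) (cuts x js)) <= t)%N.
Proof.
move=> t_gt0 x1.
have : strips x != [::].
  apply/eqP => sx; have w0 j : (j < nstrips t)%N -> width x j = 0.
    move=> jn; have : j \notin strips x by rewrite sx.
    by rewrite mem_filter mem_iota /= add0n jn andbT negbK => /eqP.
  have l0 j : (j <= nstrips t)%N -> level x j = 0.
    elim: j => [|j IHj] jn; first exact: level0.
    by rewrite levelS w0// IHj ?addr0// ltnW.
  by have := l0 _ (leqnn _); rewrite level_nstrips x1 => /eqP; rewrite oner_eq0.
have size_le : (size (strips x) <= (t./2).+1)%N.
  by rewrite size_filter (leq_trans (count_size _ _))// size_iota.
have full : size (strips x) = (t./2).+1 -> strips x = iota 0 (t./2).+1.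
  move=> e; apply/all_filterP; rewrite all_count -size_filter size_iota.
  exact/eqP.
case: (strips x) size_le full => [|j0 js] //= js_le full _.
exists j0, js; split => //.
case: js js_le full => [//|j1 js] js_le full.
rewrite -[staircase _ _]/(stair -oo%E (cut_of x j0) (cuts x (j1 :: js))).
rewrite size_stair size_map -map_comp (eq_map (g := cut_of x))// last_map.
have half_t := odd_double_half t.
have [js_eq|js_ne] := eqVneq (size (j1 :: js)) t./2; last first.
  have js_lt : (size (j1 :: js) < t./2)%N by rewrite ltn_neqAle js_ne.
  rewrite -half_t; case: (cut_of _ _).1 => [a|]; lia.
rewrite js_eq; have := full (congr1 S js_eq).
have last_iota m : last 0%N (iota 1 m) = m.
  by rewrite (last_nth 0%N) -[_ :: _]/(iota 0 m.+1) size_iota nth_iota.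
move=> /(congr1 (last 0%N)); rewrite /= last_iota => ->.
rewrite -{3}half_t addnC leq_add2r.
case: (boolP (odd t)) half_t => [|todd half_t]; first by case: (cut_of _ _).1.
(* For even t this index exceeds t, so [coord] takes its default value. *)
have v0 : coord x (t./2).*2.+1 = 0.
  by rewrite /coord insubN//; lia.
by rewrite /cut_of v0 mulr0 ltxx.
Qed.

End CutsOfPoint.

Theorem theorem2p4 (R : realType) (t : nat) (t_gt0 : (0 < t)%N)
    (mu : 'I_t -> probability (plane R) R)
    (mu_ac : forall i : 'I_t, mu i `<< @lebesgue_measure2 R) :
  exists (p : seq (segment R)) (A B : set (plane R)),
    [/\ stair_like_path p,
        (turns p <= t - 1)%N,
        path_splits p A B,
        measurable A /\ measurable B
      & forall i : 'I_t, mu i A = (1 / 2)%:E /\ mu i B = (1 / 2)%:E].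
Proof.
have [x x1 xhalf] := painted_halves mu_ac.
have [j0 [js [jsE sz]]] := size_strips t_gt0 x1.
have jsP k : k \in j0 :: js -> width x k != 0 /\ level x k.+1 <= 1.
  rewrite -jsE mem_filter mem_iota add0n => /and3P[-> _ kn]; split => //.
  by rewrite -x1 -level_nstrips le_level.
have js_path : path ltn j0 js.
  have : sorted ltn (strips x).
    by apply: sorted_filter (iota_ltn_sorted _ _); exact: ltn_trans.
  by rewrite jsE.
pose ac := cut_of x j0; pose rest := cuts x js.
have inc : increasing -oo%E rest := increasing_cuts js_path jsP.
pose A : set (plane R) := [set z | colour ac rest z.1 z.2].
have mA : measurable A := colour_measurable ac rest.
have inA j z : (j < nstrips t)%N -> level x j < squash z.2 ->
    squash z.2 < level x j.+1 -> A z = cut_colour (cut_of x j) z.1.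
  move=> jn l1 l2; rewrite /A /= (@colour_cuts _ _ _ _ _ j)//;
    last by rewrite l1.
  rewrite -jsE mem_filter mem_iota /= add0n jn andbT.
  apply: contraTneq (lt_trans l1 l2).
  by move=> w; rewrite levelS w addr0 ltxx.
have pA : painted x `<=` A.
  move=> z [j jn zj]; have [l1 l2 _] := zj; rewrite (inA j)//.
  exact: painted_strip_colour zj.
have pB : painted (- x) `<=` ~` A.
  move=> z [j jn zj]; have [l1 l2 _] := zj; rewrite !levelN in l1 l2.
  by rewrite /setC /= (inA j)//; apply/negP; exact: painted_stripN_colour zj.
exists (staircase ac rest), A, (~` A); split.
- exact: staircase_path.
- by rewrite /turns -subn1 leq_sub2r.
- exact: staircase_splits.
- by split => //; exact: measurableC.
(* Each colour class contains a set of measure 1/2 and together they have measure 1, so the seam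
   needs no separate treatment. *)
- move=> i; have [xA xB] := xhalf i.
  have AB : (mu i A + mu i (~` A) = 1)%E.
    by rewrite probability_setC// addeC subeK// fin_num_measure.
  have Age : ((1 / 2)%:E <= mu i A)%E.
    by rewrite -xA le_measure// inE//; exact: painted_measurable.
  have Bge : ((1 / 2)%:E <= mu i (~` A))%E.
    rewrite -xB le_measure// inE//; first exact: painted_measurable.
    exact: measurableC.
  move: AB Age Bge.
  rewrite -(fineK (fin_num_measure (mu i) A mA)).
  rewrite -(fineK (fin_num_measure (mu i) (~` A) (measurableC mA))).
  rewrite -EFinD !lee_fin => -[e] a b.
  by split; congr (_%:E); lra.
Qed.
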